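(* Let $G$ be any $4$-free strong bipartite Turán digraph. Then $\beta(G)\le \frac{1}{3}\gamma(G)$.
   Context: All digraphs are finite, loopless, and have no parallel edges; opposite edges $(x,y)$ and $(y,x)$ are allowed. A digraph $G$ is bipartite with partite sets $X$ and $Y$ if $V(G)$ is the disjoint union of $X$ and $Y$ and every edge of $G$ has one end in $X$ and the other in $Y$. A digraph is $m$-free if it contains no directed cycle of length at most $m$ (a pair of opposite edges is a directed cycle of length $2$); it is acyclic if it contains no directed cycle; it is strong if every vertex is reachable from every other vertex by a directed path. A $4$-free strong bipartite Turán digraph is a $4$-free strong bipartite digraph $G$ with partite sets $X$ and $Y$ that has the maximum number of edges among all $4$-free strong bipartite digraphs with the same partite sets $X$ and $Y$. For a digraph $G$, $\beta(G)$ is the minimum size of a set $S\subseteq E(G)$ such that deleting the edges of $S$ from $G$ yields an acyclic digraph. Two distinct vertices are adjacent if there is an edge between them (in either direction), and nonadjacent otherwise. For a bipartite digraph $G$ with partite sets $X$ and $Y$, $\gamma(G)$ is the number of unordered nonadjacent pairs $\{x,y\}$ with $x\in X$ and $y\in Y$ (pairs inside a partite set are not counted). *)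

(* Defs.v *)
From mathcomp Require Import all_boot all_order all_algebra.

Set Implicit Arguments.
Unset Strict Implicit.
Unset Printing Implicit Defensive.

(* A relation cannot have parallel edges, so a digraph on the finite vertex
   type V is an irreflexive [e : rel V]; opposite edges are allowed. *)

Section Digraph.

Variable V : finType.
Implicit Types (e : rel V) (X Y : {set V}) (S : {set V * V}).

Definition loopless e : Prop := irreflexive e.

Definition edges e : {set V * V} := [set p | e p.1 p.2].

(* A directed cycle is a nonempty [c : seq V] with [ucycle e c]; its length is
   [size c], and [m.-bseq V] is the type of sequences of size at most m. *)
Definition free (m : nat) e : bool :=
  [forall c : m.-bseq V, ucycleb e c ==> nilp c].

Definition acyclic e : Prop := forall c : seq V, ucycle e c -> c = [::].

Lemma acyclicP e : reflect (acyclic e) (free #|V| e).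
Proof.
apply: (iffP forallP) => [fr c ec | ac c]; last first.
  by apply/implyP => /ac ->.
have/andP[_ /card_uniqP szc] := ec.
have le_c : size c <= #|V| by rewrite -szc max_card.
by apply/nilP/(implyP (fr (Bseq le_c))).
Qed.

Definition strong e : Prop := forall x y : V, connect e x y.

Definition bipartite X Y e : Prop :=
  [/\ X :|: Y = [set: V], [disjoint X & Y]
    & forall x y, e x y -> (x \in X) && (y \in Y) || (x \in Y) && (y \in X)].

Definition free_strong_bipartite (m : nat) X Y e : Prop :=
  [/\ loopless e, bipartite X Y e, free m e & strong e].

Definition free_strong_bipartite_turan (m : nat) X Y e : Prop :=
  free_strong_bipartite m X Y e /\
  (forall e' : rel V,
     free_strong_bipartite m X Y e' -> #|edges e'| <= #|edges e|).

Definition del_edges e S : rel V := fun x y => e x y && ((x, y) \notin S).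

Definition feedback_arc_set e S : bool :=
  (S \subset edges e) && free #|V| (del_edges e S).

Lemma feedback_arc_setP e S :
  reflect (S \subset edges e /\ acyclic (del_edges e S)) (feedback_arc_set e S).
Proof. by apply: (iffP andP) => -[sSe /acyclicP]. Qed.

Lemma feedback_arc_set_edges e : feedback_arc_set e (edges e).
Proof.
apply/feedback_arc_setP; split=> // -[//|x c] /andP[+ _].
by case: c => [|y c] /= /andP[+ _]; rewrite /del_edges inE /= andbN.
Qed.

Definition beta e : nat :=
  #|[arg min_(S < edges e | feedback_arc_set e S) #|S|]|.

Lemma betaP e :
  (exists2 S, feedback_arc_set e S & #|S| = beta e) /\
  (forall S, feedback_arc_set e S -> beta e <= #|S|).
Proof.
rewrite /beta; case: arg_minnP => [|S fS minS]; first exact: feedback_arc_set_edges.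
by split=> //; exists S.
Qed.

Definition adjacent e x y : bool := (x != y) && (e x y || e y x).

(* As X and Y are disjoint, the unordered pairs {x, y} with x in X and y in Y
   are counted by the ordered pairs in X * Y. *)
Definition gamma X Y e : nat :=
  #|[set p in setX X Y | ~~ adjacent e p.1 p.2]|.

End Digraph.

(* Main.v *)
(* In a strong 4-free bipartite digraph with n > 1 vertices every strong vertex
   set extends, along a shortest ear, to a larger one, and each new vertex adds at
   least one nonadjacent pair; a shortest cycle of length 2k has k(k - 2) >= 2k - 3
   such pairs.  So gamma >= n - 3, and a blow-up of the directed hexagon shows
   gamma = n - 3 for a Turan digraph.  Equality forces every ear to be a single
   vertex with exactly one nonneighbour: the graph N of nonadjacent pairs grows by
   leaves from the perfect matching of a hexagon.  Colouring the three components
   of N by Z/3, vertices on opposite sides with distinct colours are adjacent and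
   every directed 6-cycle increases the colour by 1 along each edge, so the
   vertices fall into six cyclically ordered classes.  For two consecutive classes
   T, H let E be the edges from T to H lying on a 6-cycle.  Deleting E makes the
   digraph acyclic.  If E contains an undirected 4-cycle then all 6-cycles through
   its edges have the same opposite edge, which may be deleted instead; after
   these replacements the deleted edges correspond to a forest on T and H.  Hence
   beta <= |T| + |H| - 1, and summing over the six pairs gives
   6 (beta + 1) <= 2 n = 2 (gamma + 3). *)
Require Import Defs.
From mathcomp Require Import all_boot all_order all_algebra.
From mathcomp Require Import zify.

Set Implicit Arguments.
Unset Strict Implicit.
Unset Printing Implicit Defensive.

Definition nonadj (V : finType) (e : rel V) (X : {set V}) : rel V :=
  [rel x y | [&& (x \in X) != (y \in X), ~~ e x y & ~~ e y x]].

Definition hexagon (V : finType) (e : rel V) (a b c d p q : V) : bool :=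
  [&& e a b, e b c, e c d, e d p, e p q & e q a].

Lemma hexagon_rot (V : finType) (e : rel V) a b c d p q :
  hexagon e a b c d p q -> hexagon e b c d p q a.
Proof. by case/and5P=> ? ? ? ? /andP[? ?]; apply/and5P; split=> //; apply/andP. Qed.

(** * Hexagons and colourings by Z/3 *)

Section HexagonalStructure.

Variable V : finType.
Implicit Types (e : rel V) (X : {set V}) (tau : V -> 'Z_3) (F : {set V * V}).

Definition rev_rel e : rel V := [rel x y | e y x].

Record four_free_bip e X : Prop := FourFreeBip {
  ff_bip : forall x y, e x y -> (x \in X) != (y \in X);
  ff_no2 : forall x y, e x y -> ~~ e y x;
  ff_no4 : forall a b c d, e a b -> e b c -> e c d -> e d a -> False }.

(** The interface between the tightness argument and the cut argument. The last field says that the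
    graph of nonadjacent pairs contains no 4-cycle. *)
Record hexagonal e X tau : Prop := Hexagonal {
  hx_ff : four_free_bip e X;
  hx_adj : forall x y, (x \in X) != (y \in X) -> tau x != tau y -> e x y || e y x;
  hx_hex : forall a b c d p q, hexagon e a b c d p q -> tau b = (tau a + 1)%R;
  hx_nonadj : forall u v y z, nonadj e X u y -> nonadj e X v y ->
    nonadj e X u z -> nonadj e X v z -> u = v \/ y = z }.

Lemma nonadj_sym e X x y : nonadj e X x y = nonadj e X y x.
Proof. by rewrite /nonadj /= eq_sym [~~ e x y && _]andbC. Qed.

Lemma four_free_bip_rev e X : four_free_bip e X -> four_free_bip (rev_rel e) X.
Proof.
case=> bip n2 n4; split=> [x y /bip|x y /n2|a b c d /= ab bc cd da] //.
  by rewrite eq_sym.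
by apply: (n4 a d c b).
Qed.

Lemma nonadj_rev e X x y : nonadj (rev_rel e) X x y = nonadj e X x y.
Proof. by rewrite /nonadj /= [~~ e y x && _]andbC. Qed.

Lemma hexagon_rev e a b c d p q :
  hexagon (rev_rel e) a b c d p q = hexagon e b a q p d c.
Proof.
rewrite /hexagon /=.
by apply/idP/idP; case/and5P=> ? ? ? ? /andP[? ?]; apply/and5P; split=> //; apply/andP.
Qed.

(** Hexagons are traversed backwards in the reversed digraph, so the colour changes sign. This
    duality turns each statement about tails into one about heads. *)
Lemma hexagonal_rev e X tau :
  hexagonal e X tau -> hexagonal (rev_rel e) X (fun x => - tau x)%R.
Proof.
case=> ff adj hx nn; split.
- exact: four_free_bip_rev.
- by move=> x y sxy; rewrite GRing.eqr_opp => txy; rewrite /= orbC; apply: adj.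
- move=> a b c d p q; rewrite hexagon_rev => /hx ->.
  by rewrite GRing.opprD GRing.addrNK.
- by move=> u v y z; rewrite 4!(nonadj_rev e); apply: nn.
Qed.

Section FourFree.

Variables (e : rel V) (X : {set V}).
Hypothesis ff : four_free_bip e X.

Lemma side_neq x y : e x y -> (x \in X) = ~~ (y \in X).
Proof. by move/(ff_bip ff); case: (x \in X) (y \in X) => [] []. Qed.

(** An edge between [a] and [d], in either direction, would close one half of the hexagon to a
    directed 4-cycle. *)
Lemma hexagon_nonadj a b c d p q : hexagon e a b c d p q -> nonadj e X a d.
Proof.
case/and5P=> ab bc cd dp /andP[pq qa]; apply/and3P; split.
- by rewrite (side_neq ab) (side_neq bc) (side_neq cd) negbK; case: (d \in X).
- by apply/negP => ad; apply: (ff_no4 ff ad dp pq qa).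
- by apply/negP => da; apply: (ff_no4 ff ab bc cd da).
Qed.

End FourFree.

Section HexagonalTheory.

Variables (e : rel V) (X : {set V}) (tau : V -> 'Z_3).
Hypothesis hx : hexagonal e X tau.

Let ff := hx_ff hx.
Let no4 := ff_no4 ff.

Definition same_class x y := ((x \in X) == (y \in X)) && (tau x == tau y).

Lemma same_class_sym x y : same_class x y = same_class y x.
Proof. by rewrite /same_class eq_sym (eq_sym (tau x)). Qed.

Lemma tau_hexagon a b c d p q : hexagon e a b c d p q ->
  [/\ tau b = tau a + 1, tau c = tau a + 1 + 1, tau d = tau a, tau p = tau a + 1
    & tau q = tau a + 1 + 1]%R.
Proof.
move=> h; have t3 : (tau a + 1 + 1 + 1 = tau a)%R.
  by rewrite -!GRing.addrA -[RHS]GRing.addr0; congr (_ + _)%R; apply/val_inj.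
have h1 := hexagon_rot h; have h2 := hexagon_rot h1; have h3 := hexagon_rot h2.
have h4 := hexagon_rot h3.
have tb := hx_hex hx h; have tc := hx_hex hx h1; have td := hx_hex hx h2.
have tp := hx_hex hx h3; have tq := hx_hex hx h4.
by rewrite tq tp td tc tb t3.
Qed.

Lemma tau_succ (t : 'Z_3) : (t + 1 == t)%R = false.
Proof. by rewrite -GRing.subr_eq0 GRing.addrAC GRing.subrr GRing.add0r. Qed.

Lemma tau_succ2 (t : 'Z_3) : (t + 1 + 1 == t)%R = false.
Proof.
by rewrite -GRing.addrA -GRing.subr_eq0 GRing.addrAC GRing.subrr GRing.add0r.
Qed.

Definition hexagon_edge : rel V :=
  fun x y => [exists c, exists d, exists p, exists q, hexagon e x y c d p q].

Lemma hexagon_edgeP x y :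
  reflect (exists c d p q, hexagon e x y c d p q) (hexagon_edge x y).
Proof.
apply: (iffP existsP) => [[c /existsP[d /existsP[p /existsP[q h]]]]|].
  by exists c, d, p, q.
case=> c [d [p [q h]]]; exists c; apply/existsP; exists d; apply/existsP; exists p.
by apply/existsP; exists q.
Qed.

Lemma same_class_adj u v x : same_class u v -> (x \in X) != (u \in X) ->
  tau x != tau u -> e x v || e v x.
Proof. by case/andP=> /eqP -> /eqP ->; apply: hx_adj. Qed.

(** The colour of [f] exceeds that of [u], hence of [v], by 2, and [f] lies on the other side. *)
Lemma hexagon_last_adj u v z c y q f : same_class u v ->
  hexagon e u z c y q f -> e f v || e v f.
Proof.
move=> uv h; have [_ _ _ _ tf] := tau_hexagon h.
have fu : e f u by case/and5P: h => _ _ _ _ /andP[].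
apply: (same_class_adj uv); last by rewrite tf tau_succ2.
exact: ff_bip ff _ _ fu.
Qed.

(* Otherwise u -> g -> v -> f -> u. *)
Lemma last_exchange u v z c y q f z' c' y' q' g : same_class u v ->
  hexagon e u z c y q f -> hexagon e v z' c' y' q' g -> e v f -> e g u.
Proof.
move=> uv h h' vf; have /orP[//|ug] : e g u || e u g.
  by apply: (hexagon_last_adj _ h'); rewrite same_class_sym.
case/and5P: h => _ _ _ _ /andP[_ fu]; case/and5P: h' => _ _ _ _ /andP[_ gv].
by case: (no4 ug gv vf fu).
Qed.

End HexagonalTheory.

Section SquareHalf.

Variables (e : rel V) (X : {set V}) (tau : V -> 'Z_3).
Hypothesis hx : hexagonal e X tau.

Let ff := hx_ff hx.
Let no4 := ff_no4 ff.

Lemma same_class_opp x y : same_class X (fun x => - tau x)%R x y = same_class X tau x y.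
Proof. by congr (_ && _); apply: GRing.eqr_opp. Qed.

Lemma third_adj z w u c d p q : same_class X tau z w ->
  hexagon e u z c d p q -> e c w || e w c.
Proof.
move=> zw h.
have rh : hexagon (rev_rel e) z u q p d c by rewrite hexagon_rev.
rewrite orbC.
by apply: (hexagon_last_adj (hexagonal_rev hx) _ rh); rewrite same_class_opp.
Qed.

(** The dual of [last_exchange] under reversal. *)
Lemma third_exchange z w u v c d p q c' d' p' q' : same_class X tau z w ->
  hexagon e u z c d p q -> hexagon e v w c' d' p' q' -> e c w -> e z c'.
Proof.
move=> zw h h'.
have rh : hexagon (rev_rel e) z u q p d c by rewrite hexagon_rev.
have rh' : hexagon (rev_rel e) w v q' p' d' c' by rewrite hexagon_rev.
apply: (last_exchange (hexagonal_rev hx) _ rh rh').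
by rewrite same_class_opp.
Qed.

(** Assume that [v] and [y] are adjacent. Excluding directed 4-cycles then orients one pair after
    another, until either a 4-cycle of nonadjacent pairs or a directed 4-cycle appears. *)
Lemma square_opposite_half u v z w c y q f :
  u != v -> z != w -> same_class X tau u v -> same_class X tau z w ->
  hexagon_edge e v z -> hexagon_edge e u w -> hexagon_edge e v w ->
  hexagon e u z c y q f -> nonadj e X v y.
Proof.
move=> uv zw cuv czw /hexagon_edgeP[c1 [y1 [q1 [f1 h1]]]].
move=> /hexagon_edgeP[c3 [y3 [q3 [f3 h3]]]] /hexagon_edgeP[c2 [y2 [q2 [f2 h2]]]] h.
have uz := hexagon_nonadj ff h.
case/and5P: (h) => euz ezc ecy eyq /andP[eqf efu].
case/and5P: (h1) => evz ezc1 ecy1 eyq1 /andP[eqf1 efv1].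
case/and5P: (h2) => evw ewc2 ecy2 eyq2 /andP[eqf2 efv2].
case/and5P: (h3) => euw _ _ _ _.
apply/negPn/negP => nvy.
(* Otherwise [v z c y q f] is a hexagon, in which [y] is opposite to [v]. *)
have evf : e v f.
  case/orP: (hexagon_last_adj hx cuv h) => // efv; case/negP: nvy.
  by apply: (@hexagon_nonadj e X ff v z c y q f); apply/and5P; split=> //; apply/andP.
have evy : e v y.
  have : e v y || e y v.
    move: nvy; rewrite /nonadj /=; case/and3P: uz => + _ _.
    by case/andP: cuv => /eqP -> _ ->; rewrite /= -negb_or negbK.
  by case/orP => // eyv; case: (no4 evz ezc ecy eyv).
have f1u : e f1 u := last_exchange hx cuv h h1 evf.
have f2u : e f2 u := last_exchange hx cuv h h2 evf.
(* If [w] and [q] are nonadjacent, then [z] and [w] have the common nonneighbour [q] and, according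
   to the direction between [c1] and [w], a second one, [q2] or [q1]. *)
have [nwq|nwq] := boolP (nonadj e X w q).
  have q1q : q1 != q.
    by apply/eqP => q1q; apply: (no4 evy eyq _ efv1); rewrite -q1q.
  have q2q : q2 != q.
    by apply/eqP => q2q; apply: (no4 evy eyq _ efv2); rewrite -q2q.
  have nzq : nonadj e X z q := hexagon_nonadj ff (hexagon_rot h).
  have nzq1 : nonadj e X z q1 := hexagon_nonadj ff (hexagon_rot h1).
  have nwq2 : nonadj e X w q2 := hexagon_nonadj ff (hexagon_rot h2).
  have [wc1|] := orP (third_adj czw h1).
    have nzq2 : nonadj e X z q2.
      have zc2 := third_exchange czw h1 h2 wc1.
      apply: (@hexagon_nonadj e X ff z c2 y2 q2 f2 v).
      by apply/and5P; split=> //; apply/andP.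
    by case: (hx_nonadj hx nzq nwq nzq2 nwq2) => /eqP; rewrite ?(negbTE zw) // eq_sym (negbTE q2q).
  move=> wc1; have nwq1 : nonadj e X w q1.
    apply: (@hexagon_nonadj e X ff w c1 y1 q1 f1 v).
    by apply/and5P; split=> //; apply/andP.
  by case: (hx_nonadj hx nzq nwq nzq1 nwq1) => /eqP; rewrite ?(negbTE zw) // eq_sym (negbTE q1q).
(* Otherwise [u w c y q f] is a hexagon with [q] opposite to [w]. The orientations found from here
   on end in the directed 4-cycle [q2 y c2 y2]. *)
have cw : e c w.
  case/orP: (third_adj czw h) => // ewc; case/negP: nwq.
  apply: (@hexagon_nonadj e X ff w c y q f u).
  by apply/and5P; split=> //; apply/andP.
have zc2 : e z c2 := third_exchange czw h h2 cw.
have qw : e q w.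
  have : e w q || e q w.
    have nzq := hexagon_nonadj ff (hexagon_rot h).
    move: nwq; rewrite /nonadj /=; case/and3P: nzq => + _ _.
    by case/andP: czw => /eqP -> _ ->; rewrite /= -negb_or negbK.
  by case/orP => // ewq; case: (no4 ewq eqf efu euw).
have side := side_neq ff.
have [_ tc ty tq tf] := tau_hexagon hx h.
have [tw tc2 ty2 tq2 tf2] := tau_hexagon hx h2.
have tuv : tau u = tau v by case/andP: cuv => _ /eqP.
have suv : (u \in X) = (v \in X) by case/andP: cuv => /eqP.
have qy2 : e q y2.
  have : e q y2 || e y2 q.
    apply: (hx_adj hx); last by rewrite tq ty2 tuv tau_succ.
    by rewrite (side _ _ eqf) (side _ _ efu) suv (side _ _ evw) (side _ _ ewc2) (side _ _ ecy2); case: (y2 \in X).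
  by case/orP => // y2q; case: (no4 y2q qw ewc2 ecy2).
have q2y : e q2 y.
  have : e q2 y || e y q2.
    apply: (hx_adj hx); last by rewrite tq2 ty tuv tau_succ.
    by rewrite (side _ _ eqf2) (side _ _ efv2) -suv (side _ _ euz) (side _ _ ezc) (side _ _ ecy); case: (y \in X).
  by case/orP => // yq2; case: (no4 yq2 eqf2 efv2 evy).
have yc2 : e y c2.
  have : e y c2 || e c2 y.
    apply: (hx_adj hx); last by rewrite ty tc2 tuv eq_sym tau_succ2.
    by rewrite (side _ _ eyq) (side _ _ eqf) (side _ _ efu) suv (side _ _ evw) (side _ _ ewc2); case: (c2 \in X).
  by case/orP => // c2y; case: (no4 c2y eyq qw ewc2).
exact: no4 q2y yc2 ecy2 eyq2.
Qed.

End SquareHalf.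
End HexagonalStructure.

(** * Acyclic relations and forests *)

Section Relations.

Variables (V : finType) (r : rel V).

(** The number of reachable vertices is a rank that strictly drops along edges: if [x] were
    reachable from [y], the edge would lie on a cycle. *)
Lemma acyclic_connect_card x y :
  acyclic r -> r x y -> #|connect r y| < #|connect r x|.
Proof.
move=> ac rxy; apply/proper_card/properP; split.
  by apply/subsetP => z; rewrite !inE => yz; apply: connect_trans (connect1 rxy) yz.
exists x; rewrite inE ?connect0 //; apply/negP => /connectP[p pth lst].
case: (shortenP pth) lst => p' pth' up' _ lst.
suff /ac : ucycle r (y :: p') by [].
by rewrite /ucycle /ucycleb up' andbT /= rcons_path pth' -lst rxy.
Qed.

Lemma acyclic_no_walk (x : nat -> V) :
  acyclic r -> ~ (forall n, r (x n) (x n.+1)).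
Proof.
move=> ac wx.
have H n : #|connect r (x n)| + n <= #|V|.
  elim: n => [|n IH]; first by rewrite addn0 max_card.
  by apply: leq_trans IH; rewrite addnS ltn_add2r acyclic_connect_card.
by have := H #|V|.+1; rewrite addnS ltnNge leq_addl.
Qed.

Lemma acyclic_no_rev_walk (x : nat -> V) :
  acyclic r -> ~ (forall n, r (x n.+1) (x n)).
Proof.
move=> ac wx.
have H n : n <= #|connect r (x n)|.
  by elim: n => // n IH; apply: leq_ltn_trans IH _; apply: acyclic_connect_card.
have := H #|V|.+1; rewrite ltnNge; case/negP; exact: max_card.
Qed.

(** Take a cycle of minimum length; any edge between its vertices other than a cycle step would be a
    shortcut. *)
Lemma chordless_cycle (c0 : seq V) : ucycle r c0 -> c0 != [::] ->
  exists c, [/\ ucycle r c, c != [::] &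
    forall x y, x \in c -> y \in c -> r x y -> y = next c x].
Proof.
move=> uc0 nc0.
pose P n := [exists t : n.-tuple V, ucycleb r t && (t != [::] :> seq V)].
have exP : exists n, P n.
  by exists (size c0); apply/existsP; exists (in_tuple c0); rewrite /= nc0 andbT.
case: (ex_minnP exP) => n /existsP[[c /= szc] /andP[uc nc]] minn.
have min c' : ucycle r c' -> c' != [::] -> size c <= size c'.
  move=> uc' nc'; rewrite (eqP szc); apply: minn.
  by apply/existsP; exists (in_tuple c'); rewrite /= nc' andbT.
exists c; split=> // x y xc yc rxy.
have [i s def_s] := rot_to xc.
have us : ucycle r (x :: s) by rewrite -def_s; apply/andP; rewrite rot_cycle rot_uniq; apply/andP.
have uniqc : uniq c by case/andP: uc.
rewrite -(next_rot i uniqc) def_s.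
have szs : size c = (size s).+1 by rewrite -(size_rot i) def_s.
have : y \in x :: s by rewrite -def_s mem_rot.
case/andP: us => cs; rewrite cons_uniq => /andP[xs us].
rewrite inE => /predU1P[yx|ys].
  have := min [:: x]; rewrite /ucycle /ucycleb /= -{2}yx rxy szs => /(_ isT isT).
  by case: s {szs cs xs us def_s} => //= _; rewrite eqxx yx.
case/splitPr: ys cs us xs szs {def_s} => s1 s2 cs us xs szs.
case: s1 cs us xs szs => [|z s1] cs us xs szs; first by rewrite /= eqxx.
(* The edge from [x] to [y] bypasses the nonempty segment [z :: s1]. *)
suff : size c <= size (x :: y :: s2) by rewrite szs /= size_cat /=; lia.
apply: min => //; apply/andP; split; last first.
  move: us; rewrite cat_uniq => /and3P[_ _ us]; rewrite cons_uniq us andbT.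
  by apply: contra xs => xs; rewrite mem_cat xs orbT.
rewrite /= rxy /=; move: cs; rewrite /= rcons_cat cat_path /=.
by case/and3P=> _ _ /andP[].
Qed.

End Relations.

(** The last hypothesis expresses that [M] is a forest: every nonempty set of its edges has a leaf.
    Induction removes a leaf together with its edge. *)
Lemma forest_card (T : finType) (M : {set T * T}) (S : {set T}) :
  S != set0 -> (forall p, p \in M -> [&& p.1 \in S, p.2 \in S & p.1 != p.2]) ->
  (forall M' : {set T * T}, M' \subset M -> M' != set0 -> exists x,
     #|[set p in M' | (p.1 == x) || (p.2 == x)]| = 1) ->
  #|M| < #|S|.
Proof.
elim: {M}_.+1 {-2}M (ltnSn #|M|) S => // n IH M leM S S0 MS leaf.
have [->|M0] := eqVneq M set0; first by rewrite cards0 card_gt0.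
have [x /eqP/cards1P[p def_p]] := leaf M (subxx _) M0.
have : p \in [set p in M | (p.1 == x) || (p.2 == x)] by rewrite def_p set11.
rewrite inE => /andP[pM px].
have xS : x \in S by case/and3P: (MS p pM) => p1 p2 _; case/orP: px => /eqP <-.
have cM : #|M| = #|M :\ p|.+1 by rewrite (cardsD1 p M) pM.
have cS : #|S| = #|S :\ x|.+1 by rewrite (cardsD1 x S) xS.
rewrite cM cS ltnS; apply: IH.
- by rewrite -cM.
- case/and3P: (MS p pM) => p1 p2 p12; apply/set0Pn.
  by case/orP: px => /eqP <-; [exists p.2|exists p.1]; rewrite !inE ?p1 ?p2 andbT // eq_sym.
- move=> p'; rewrite !inE => /andP[p'p p'M]; case/and3P: (MS p' p'M) => -> -> ->.
  rewrite !andbT -negb_or; apply/negP => p'x.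
  have : p' \in [set p in M | (p.1 == x) || (p.2 == x)] by rewrite inE p'M.
  by rewrite def_p inE (negbTE p'p).
- by move=> M' sM'; apply: leaf; apply: subset_trans sM' (subsetDl _ _).
Qed.

(** * Undirected 4-cycles of hexagon edges *)

Section Squares.

Variable V : finType.
Implicit Types (X : {set V}) (tau : V -> 'Z_3) (F : {set V * V}).

Lemma hexagon_edge_rev (e : rel V) x y :
  hexagon_edge (rev_rel e) x y = hexagon_edge e y x.
Proof.
apply/hexagon_edgeP/hexagon_edgeP=> -[c [d [p [q h]]]]; exists q, p, d, c.
  by rewrite -hexagon_rev.
by rewrite hexagon_rev.
Qed.

Variables (e : rel V) (X : {set V}) (tau : V -> 'Z_3).
Hypothesis hx : hexagonal e X tau.

Let ff := hx_ff hx.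
Let no4 := ff_no4 ff.

Definition square u v z w :=
  [/\ u != v, z != w, same_class X tau u v, same_class X tau z w &
   [/\ hexagon_edge e u z, hexagon_edge e v z, hexagon_edge e u w & hexagon_edge e v w]].

Lemma square_swap_l u v z w : square u v z w -> square v u z w.
Proof. by case=> uv zw suv szw [? ? ? ?]; split; rewrite // 1?eq_sym 1?same_class_sym. Qed.

Lemma square_swap_r u v z w : square u v z w -> square u v w z.
Proof. by case=> uv zw suv szw [? ? ? ?]; split; rewrite // 1?eq_sym 1?same_class_sym. Qed.

Lemma square_opposite u v z w c y q f : square u v z w -> hexagon e u z c y q f ->
  [/\ nonadj e X u y, nonadj e X v y, nonadj e X z q & nonadj e X w q].
Proof.
case=> uv zw suv szw [euz evz euw evw] h; split.
- exact: hexagon_nonadj ff _ _ _ _ _ _ h.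
- by have := (square_opposite_half hx uv zw suv szw evz euw evw h).
- exact: hexagon_nonadj ff _ _ _ _ _ _ (hexagon_rot h).
- have rh : hexagon (rev_rel e) z u f q y c by rewrite hexagon_rev.
  rewrite -(nonadj_rev e); apply: (square_opposite_half (hexagonal_rev hx) zw uv _ _ _ _ _ rh).
  by rewrite same_class_opp.
  by rewrite same_class_opp.
  by rewrite hexagon_edge_rev.
  by rewrite hexagon_edge_rev.
  by rewrite hexagon_edge_rev.
Qed.

Lemma square_unique u v z w c y q f u' z' c' y' q' f' : square u v z w ->
  u' \in [:: u; v] -> z' \in [:: z; w] ->
  hexagon e u z c y q f -> hexagon e u' z' c' y' q' f' -> (y, q) = (y', q').
Proof.
move=> sq; rewrite !inE => u'E z'E h h'.
have [uy vy zq wq] := square_opposite sq h.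
have [uy' vy' zq' wq'] : [/\ nonadj e X u y', nonadj e X v y', nonadj e X z q' & nonadj e X w q'].
  case/orP: u'E h' => /eqP->; case/orP: z'E => /eqP -> h'.
  - exact: square_opposite sq h'.
  - by case: (square_opposite (square_swap_r sq) h').
  - by case: (square_opposite (square_swap_l sq) h').
  - by case: (square_opposite (square_swap_r (square_swap_l sq)) h').
case: sq => uv zw _ _ _.
case: (hx_nonadj hx uy vy uy' vy') => [/eqP|<-]; first by rewrite (negbTE uv).
by case: (hx_nonadj hx zq wq zq' wq') => [/eqP|<-]; first by rewrite (negbTE zw).
Qed.

Variables (i : 'Z_3) (s : bool).

(** The six classes are indexed by a colour [i] and a side [s]; [head_class] is the successor of
    [tail_class] in their cyclic order. *)
Definition tail_class : {set V} := [set x | ((x \in X) == s) && (tau x == i)].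
Definition head_class : {set V} := [set x | ((x \in X) == ~~ s) && (tau x == (i + 1)%R)].
Definition class_edges : {set V * V} :=
  [set p | (p.1 \in tail_class) && hexagon_edge e p.1 p.2].

Lemma class_edges_head p : p \in class_edges -> p.2 \in head_class.
Proof.
rewrite !inE => /andP[/andP[/eqP sp /eqP tp] /hexagon_edgeP[c [d [y [q h]]]]].
have e12 : e p.1 p.2 by case/and5P: h.
rewrite (hx_hex hx h) tp eqxx andbT -sp (side_neq ff e12) negbK; exact: eqxx.
Qed.

Lemma tail_head x : x \in tail_class -> x \in head_class -> False.
Proof. by rewrite !inE => /andP[/eqP -> _] /andP[]; case: s. Qed.

Lemma tail_same x y : x \in tail_class -> y \in tail_class -> same_class X tau x y.
Proof. by rewrite !inE /same_class => /andP[/eqP-> /eqP->] /andP[/eqP-> /eqP->]; rewrite !eqxx. Qed.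

Lemma head_same x y : x \in head_class -> y \in head_class -> same_class X tau x y.
Proof. by rewrite !inE /same_class => /andP[/eqP-> /eqP->] /andP[/eqP-> /eqP->]; rewrite !eqxx. Qed.

Lemma tail_head_adj u z : u \in tail_class -> z \in head_class -> e u z || e z u.
Proof.
rewrite !inE => /andP[/eqP su /eqP tu] /andP[/eqP sz /eqP tz].
apply: (hx_adj hx); first by rewrite su sz; case: s.
by rewrite tu tz eq_sym tau_succ.
Qed.

(** Both cross pairs are adjacent by their colours. If both went from tail to head, exchanging the
    last vertices of the two hexagons would put [(u, w)] or [(v, z)] on a hexagon; if both went
    back, [u z v w] would be a directed 4-cycle. *)
Lemma cross_sign u z v w : (u, z) \in class_edges -> (v, w) \in class_edges ->
  (u, w) \notin class_edges -> (v, z) \notin class_edges -> e u w = e z v.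
Proof.
move=> uzE vwE uwE vzE.
have zH := class_edges_head uzE; have wH := class_edges_head vwE.
have uT : u \in tail_class by case/setIdP: uzE.
have vT : v \in tail_class by case/setIdP: vwE.
have /hexagon_edgeP[c [y [q [f h]]]] : hexagon_edge e u z by case/setIdP: uzE.
have /hexagon_edgeP[c' [y' [q' [f' h']]]] : hexagon_edge e v w by case/setIdP: vwE.
case/and5P: (h) => euz ezc ecy eyq /andP[eqf efu].
case/and5P: (h') => evw ezc' ecy' eyq' /andP[eqf' efv'].
have cuv := tail_same uT vT.
apply/idP/idP => [uw|zv].
  case/orP: (tail_head_adj vT zH) => // vz; exfalso.
  case/orP: (hexagon_last_adj hx cuv h) => [fv|vf].
    case/negP: vzE; rewrite inE vT; apply/hexagon_edgeP; exists c, y, q, f.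
    by apply/and5P; split=> //; apply/andP.
  have f'u := last_exchange hx cuv h h' vf.
  case/negP: uwE; rewrite inE uT; apply/hexagon_edgeP; exists c', y', q', f'.
  by apply/and5P; split=> //; apply/andP.
case/orP: (tail_head_adj uT wH) => // wu.
by case: (no4 euz zv evw wu).
Qed.

Definition in_square (p : V * V) : bool :=
  [exists v, exists w,
    [&& p.1 != v, p.2 != w, same_class X tau p.1 v, same_class X tau p.2 w &
     [&& hexagon_edge e p.1 p.2, hexagon_edge e v p.2, hexagon_edge e p.1 w & hexagon_edge e v w]]].

Lemma in_squareP p : reflect (exists v w, square p.1 v p.2 w) (in_square p).
Proof.
apply: (iffP existsP) => [[v /existsP[w /and5P[? ? ? ? /and4P[? ? ? ?]]]]|[v [w]]].
  by exists v, w.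
by case=> ? ? ? ? [? ? ? ?]; exists v; apply/existsP; exists w; apply/and5P; split=> //; apply/and4P.
Qed.

(** For an edge of a square the choice of the hexagon is immaterial by [square_unique]. The default
    [p] is returned only when [p] lies on no hexagon. *)
Definition opposite_edge (p : V * V) : V * V :=
  odflt p [pick r : V * V | [exists c, exists f, hexagon e p.1 p.2 c r.1 r.2 f]].

Definition cut_edge (p : V * V) : V * V := if in_square p then opposite_edge p else p.

Lemma square_cut_edge u v z w : square u v z w ->
  forall u' z' c y q f, u' \in [:: u; v] -> z' \in [:: z; w] ->
  hexagon e u' z' c y q f -> cut_edge (u', z') = (y, q).
Proof.
move=> sq u' z' c y q f u'E z'E h.
have sq' : exists v' w', square u' v' z' w'.
  move: u'E z'E; rewrite !inE => /orP[] /eqP-> /orP[] /eqP ->.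
  - by exists v, w.
  - by exists v, z; apply: square_swap_r.
  - by exists u, w; apply: square_swap_l.
  - by exists u, z; apply/square_swap_l/square_swap_r.
rewrite /cut_edge (introT (in_squareP (u', z')) sq') /opposite_edge; case: pickP => /=.
  case=> y' q' /existsP[c' /existsP[f' /= h']]; case: sq' => v' [w' sq'].
  by apply: (square_unique sq' _ _ h' h); rewrite inE eqxx.
by move/(_ (y, q))/existsP; case; exists c; apply/existsP; exists f.
Qed.

Lemma square_cut_edge_eq u v z w : square u v z w -> forall a b a' b',
  a \in [:: u; v] -> b \in [:: z; w] -> a' \in [:: u; v] -> b' \in [:: z; w] ->
  hexagon_edge e a b -> hexagon_edge e a' b' -> cut_edge (a, b) = cut_edge (a', b').
Proof.
move=> sq a b a' b' aE bE a'E b'E /hexagon_edgeP[c [y [q [f h]]]].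
move=> /hexagon_edgeP[c' [y' [q' [f' h']]]].
have [_ _ _ _ [/hexagon_edgeP[c0 [y0 [q0 [f0 h0]]]] _ _ _]] := sq.
rewrite (square_cut_edge sq aE bE h) (square_cut_edge sq a'E b'E h').
by rewrite -(square_unique sq aE bE h0 h) -(square_unique sq a'E b'E h0 h').
Qed.

Definition cut_set : {set V * V} := cut_edge @: class_edges.

Lemma cut_edge_hexagon u z c y q f : hexagon e u z c y q f ->
  cut_edge (u, z) = (u, z) \/ cut_edge (u, z) = (y, q).
Proof.
move=> h; have [/in_squareP[v [w sq]]|nsq] := boolP (in_square (u, z)).
  by right; apply: (square_cut_edge sq _ _ h); rewrite inE eqxx.
by left; rewrite /cut_edge (negbTE nsq).
Qed.

Definition transversal_edge (r : V * V) : V * V :=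
  odflt r [pick p in class_edges | cut_edge p == r].

(** A deleted edge may be an opposite edge, which does not run from [tail_class] to [head_class].
    One representative in [class_edges] for each deleted edge brings the count back to these two
    classes. *)
Definition cut_transversal : {set V * V} := transversal_edge @: cut_set.

Lemma cut_transversal_edgeP r : r \in cut_set ->
  transversal_edge r \in class_edges /\ cut_edge (transversal_edge r) = r.
Proof.
case/imsetP=> p pE ->; rewrite /transversal_edge; case: pickP => /=.
  by move=> p' /andP[p'E /eqP].
by move/(_ p); rewrite pE eqxx.
Qed.

Lemma card_cut_transversal : #|cut_transversal| = #|cut_set|.
Proof.
apply: card_in_imset => r r' /cut_transversal_edgeP[_ rE] /cut_transversal_edgeP[_ r'E] eq_rr'.
by rewrite -rE -r'E eq_rr'.
Qed.

Lemma cut_transversal_inj p p' :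
  p \in cut_transversal -> p' \in cut_transversal -> cut_edge p = cut_edge p' -> p = p'.
Proof.
case/imsetP=> r /cut_transversal_edgeP[_ rE] ->; case/imsetP=> r' /cut_transversal_edgeP[_ r'E] ->.
by rewrite rE r'E => ->.
Qed.

Lemma cut_transversal_sub : cut_transversal \subset class_edges.
Proof. by apply/subsetP => _ /imsetP[r /cut_transversal_edgeP[rE _] ->]. Qed.

End Squares.

(** * Feedback arc sets from hexagon edges *)

Section Cut.

Variables (V : finType) (e : rel V) (X : {set V}) (tau : V -> 'Z_3).
Hypothesis hx : hexagonal e X tau.
Hypothesis hexagon_in_cycle : forall c, ucycle e c -> c != [::] ->
  exists a b d p q f, hexagon e a b d p q f /\ all (mem c) [:: a; b; d; p; q; f].

Let ff := hx_ff hx.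
Let no4 := ff_no4 ff.

Lemma Z3_cases (t u : 'Z_3) : [\/ t = u, (t + 1 = u)%R | (t + 1 + 1 = u)%R].
Proof.
rewrite -(GRing.subrK t u); case: (u - t)%R => [[|[|[|//]]] lt3].
- by apply: Or31; rewrite -[LHS]GRing.add0r; congr (_ + _)%R; apply: val_inj.
- by apply: Or32; rewrite GRing.addrC; congr (_ + _)%R; apply: val_inj.
- by apply: Or33; rewrite -GRing.addrA GRing.addrC; congr (_ + _)%R; apply: val_inj.
Qed.

Variables (i : 'Z_3) (s : bool).
Local Notation tail_class := (tail_class X tau i s).
Local Notation head_class := (head_class X tau i s).
Local Notation class_edges := (class_edges e X tau i s).
Local Notation cut_set := (cut_set e X tau i s).
Local Notation cut_transversal := (cut_transversal e X tau i s).

(** One of the first three vertices has colour [i]; the vertex three steps later has the same colour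
    and the other side, so a rotation reaches the required class. *)
Lemma hexagon_tail_class (P : pred V) a b c d p q :
  hexagon e a b c d p q -> all P [:: a; b; c; d; p; q] ->
  exists a' b' c' d' p' q',
    [/\ hexagon e a' b' c' d' p' q', all P [:: a'; b'; c'; d'; p'; q'] & a' \in tail_class].
Proof.
move=> h /and5P[Pa Pb Pc Pd /and3P[Pp Pq _]].
have rotP a' b' c' d' p' q' : hexagon e a' b' c' d' p' q' ->
    all P [:: a'; b'; c'; d'; p'; q'] -> tau a' = i ->
  exists a' b' c' d' p' q',
    [/\ hexagon e a' b' c' d' p' q', all P [:: a'; b'; c'; d'; p'; q'] & a' \in tail_class].
  move=> h' P' ta'; have [/eqP sa'|sa'] := boolP ((a' \in X) == s).
    by exists a', b', c', d', p', q'; split=> //; rewrite inE sa' ta' !eqxx.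
  have h3 := hexagon_rot (hexagon_rot (hexagon_rot h')).
  exists d', p', q', a', b', c'; split=> //.
    by case/and5P: P' => ? ? ? ? /and3P[? ? _]; apply/and5P; split=> //; apply/and3P.
  have [_ _ td' _ _] := tau_hexagon hx h'.
  case/and3P: (hexagon_nonadj ff h') => + _ _.
  by rewrite inE td' ta' eqxx andbT; case: (a' \in X) sa'; case: (d' \in X); case: s.
have h1 := hexagon_rot h; have h2 := hexagon_rot h1.
have [tb tc _ _ _] := tau_hexagon hx h.
case: (Z3_cases (tau a) i) => ti.
- by apply: (rotP a b c d p q) => //=; rewrite Pa Pb Pc Pd Pp Pq.
- by apply: (rotP b c d p q a); rewrite ?tb //= Pa Pb Pc Pd Pp Pq.
- by apply: (rotP c d p q a b); rewrite ?tc //= Pa Pb Pc Pd Pp Pq.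
Qed.

(** A chordless cycle avoiding [F] contains the vertices of a hexagon that starts in [tail_class].
    It turns out to have no further vertices, so it runs through both [(a, b)] and [(d, p)], one of
    which lies in [F]. *)
Lemma cut_acyclic (F : {set V * V}) :
  (forall x y, (x, y) \in F -> tau x = i /\ (tau y = i + 1)%R) ->
  (forall a b c d p q, hexagon e a b c d p q -> a \in tail_class ->
     (a, b) \in F \/ (d, p) \in F) ->
  acyclic (del_edges e F).
Proof.
move=> Ftau Fhex c0 uc0; apply/eqP/negPn/negP => nc0.
have [z [uz nz chord]] := chordless_cycle uc0 nc0.
have [cyc uniqz] : cycle (del_edges e F) z /\ uniq z by apply/andP.
have uez : ucycle e z.
  by rewrite /ucycle /ucycleb uniqz (sub_cycle _ cyc) // => x y /andP[].
have [a0 [b0 [d0 [p0 [q0 [f0 [h0 z0]]]]]]] := hexagon_in_cycle uez nz.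
have [a [b [c [d [p [q [h]]]]]]] := hexagon_tail_class h0 z0.
move=> /and5P[az bz cz dz /and3P[pz qz _]] aT.
have ta : tau a = i by move: aT; rewrite inE => /andP[_ /eqP].
have [tb tc td tp tq] := tau_hexagon hx h; rewrite ta in tb tc td tp tq.
case/and5P: (h) => eab ebc ecd edp /andP[epq eqa].
have i1 := tau_succ i; have i2 := tau_succ2 i.
have i12 : (i + 1 + 1 == i + 1)%R = false by rewrite tau_succ.
(* An edge not going from colour [i] to colour [i + 1] is never deleted, so chordlessness makes it a
   step of the cycle. *)
have nxt x y : x \in z -> y \in z -> e x y -> tau x != i \/ (tau y != i + 1)%R -> y = next z x.
  move=> xz yz xy t; apply: chord => //; rewrite /del_edges xy /=.
  by apply/negP => /Ftau[tx ty]; move: t; rewrite tx ty !eqxx; case.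
have nb : c = next z b by apply: nxt => //; left; rewrite tb i1.
have nc : d = next z c by apply: nxt => //; left; rewrite tc i2.
have np : q = next z p by apply: nxt => //; left; rewrite tp i1.
have nq : a = next z q by apply: nxt => //; left; rewrite tq i2.
have adj x y : (x \in X) != (y \in X) -> tau x != tau y -> e x y || e y x := @hx_adj _ _ _ _ hx x y.
have sq : (q \in X) = ~~ (a \in X) := side_neq ff eqa.
have sp : (p \in X) = (a \in X) by rewrite (side_neq ff epq) sq negbK.
have sd : (d \in X) = ~~ (a \in X) by rewrite (side_neq ff edp) sp.
have sc : (c \in X) = (a \in X) by rewrite (side_neq ff ecd) sd negbK.
have sb : (b \in X) = ~~ (a \in X) by rewrite (side_neq ff ebc) sc.
have next_inj x y : next z x = next z y -> x = y.
  by move=> xy; rewrite -(prev_next uniqz x) xy prev_next.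
(* Compare [x] with hexagon vertices of the other side and another colour. Edges that are never
   deleted identify [x] through its successor or predecessor on the cycle; the other directions give
   a colour clash or a directed 4-cycle. *)
have hexz x : x \in z -> x \in [:: a; b; c; d; p; q].
  move=> xz; rewrite !inE; have [tx|tx] := eqVneq (tau x) (i + 1 + 1)%R.
    have [sx|sx] := eqVneq (x \in X) (c \in X).
      suff -> : x = c by rewrite eqxx ?orbT.
      have /orP[xb|bx] : e x b || e b x.
        by apply: adj; rewrite ?tx ?tb ?i12 // sx sb sc; case: (a \in X).
        have xnb : b = next z x by apply: nxt => //; left; rewrite tx i2.
        have /orP[xd|dx] : e x d || e d x.
          by apply: adj; rewrite ?tx ?td ?i2 // sx sc sd; case: (a \in X).
          have : d = next z x by apply: nxt => //; left; rewrite tx i2.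
          by rewrite -xnb => db; move: tb; rewrite -db td => /esym/eqP; rewrite i1.
        by case: (no4 dx xb ebc ecd).
      by rewrite nb; apply: nxt => //; left; rewrite tb i1.
    suff -> : x = q by rewrite eqxx ?orbT.
    have sxq : (x \in X) = ~~ (a \in X).
      by move: sx; rewrite sc; case: (x \in X); case: (a \in X).
    have /orP[xp|px] : e x p || e p x.
      by apply: adj; rewrite ?tx ?tp ?i12 // sxq sp; case: (a \in X).
      have xnp : p = next z x by apply: nxt => //; left; rewrite tx i2.
      have /orP[xa|ax] : e x a || e a x.
        by apply: adj; rewrite ?tx ?ta ?i2 // sxq; case: (a \in X).
        have : a = next z x by apply: nxt => //; left; rewrite tx i2.
        by rewrite -xnp => pa; move: tp; rewrite -pa ta => /esym/eqP; rewrite i1.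
      by case: (no4 ax xp epq eqa).
    by rewrite np; apply: nxt => //; left; rewrite tp i1.
  have [sx|sx] := eqVneq (x \in X) (c \in X).
    have /orP[xq|qx] : e x q || e q x.
      by apply: adj; rewrite ?tq // sx sc sq; case: (a \in X).
      suff -> : x = p by rewrite eqxx ?orbT.
      by apply: next_inj; rewrite -np; apply/esym/nxt => //; right; rewrite tq i12.
    suff -> : x = a by rewrite eqxx ?orbT.
    by rewrite nq; apply: nxt => //; left; rewrite tq i2.
  have /orP[xc|cx] : e x c || e c x by apply: adj; rewrite ?tc.
    suff -> : x = b by rewrite eqxx ?orbT.
    by apply: next_inj; rewrite -nb; apply/esym/nxt => //; right; rewrite tc i12.
  suff -> : x = d by rewrite eqxx ?orbT.
  by rewrite nc; apply: nxt => //; left; rewrite tc i2.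
(* Of the six vertices, sides, the nonadjacency of [a] and [d], and the edge from [q] to [a] leave
   only [b]. *)
have nexta : next z a = b.
  have /andP[ey _] := next_cycle cyc az.
  have : next z a \in z by rewrite mem_next.
  move/hexz; rewrite !inE => /or4P[/eqP y|/eqP y|/eqP y|/or3P[]/eqP y] //; rewrite y in ey.
  - by have := side_neq ff ey; case: (a \in X).
  - by have := side_neq ff ey; rewrite sc; case: (a \in X).
  - by case/and3P: (hexagon_nonadj ff h) => _ /negP.
  - by have := side_neq ff ey; rewrite sp; case: (a \in X).
  - by case/negP: (ff_no2 ff ey).
have nextd : next z d = p.
  have /andP[ey _] := next_cycle cyc dz.
  have : next z d \in z by rewrite mem_next.
  move/hexz; rewrite !inE => /or4P[/eqP y|/eqP y|/eqP y|/or3P[]/eqP y] //; rewrite y in ey.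
  - by case/and3P: (hexagon_nonadj ff h) => _ _ /negP.
  - by have := side_neq ff ey; rewrite sd sb; case: (a \in X).
  - by case/negP: (ff_no2 ff ey).
  - by have := side_neq ff ey; case: (d \in X).
  - by have := side_neq ff ey; rewrite sd sq; case: (a \in X).
have /andP[_ nab] := next_cycle cyc az; have /andP[_ ndp] := next_cycle cyc dz.
by case: (Fhex _ _ _ _ _ _ h aT); rewrite -?nexta -?nextd; apply/negP.
Qed.

End Cut.

(** * The size of the cut: a forest on two consecutive classes *)

Section CutSize.

Variables (V : finType) (e : rel V) (X : {set V}) (tau : V -> 'Z_3).
Hypothesis hx : hexagonal e X tau.
Hypothesis hexagon_in_cycle : forall c, ucycle e c -> c != [::] ->
  exists a b d p q f, hexagon e a b d p q f /\ all (mem c) [:: a; b; d; p; q; f].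

Let ff := hx_ff hx.
Let no4 := ff_no4 ff.

Variables (i : 'Z_3) (s : bool).
Local Notation tail_class := (tail_class X tau i s).
Local Notation head_class := (head_class X tau i s).
Local Notation class_edges := (class_edges e X tau i s).
Local Notation cut_set := (cut_set e X tau i s).
Local Notation cut_transversal := (cut_transversal e X tau i s).

Lemma class_edges_acyclic : acyclic (del_edges e class_edges).
Proof.
apply: (cut_acyclic hx hexagon_in_cycle (i := i) (s := s)) => [x y xyE|a b c d p q h aT].
  have := class_edges_head hx xyE; case/setIdP: xyE => + _.
  by rewrite !inE => /andP[_ /eqP ->] /andP[_ /eqP ->].
by left; rewrite inE aT; apply/hexagon_edgeP; exists c, d, p, q.
Qed.

Lemma cut_setP r : r \in cut_set ->
  exists u z c y q f, [/\ u \in tail_class, hexagon e u z c y q f & r = (u, z) \/ r = (y, q)].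
Proof.
case/imsetP=> -[u z] /setIdP[/= uT /hexagon_edgeP[c [y [q [f h]]]]] ->.
by exists u, z, c, y, q, f; split=> //; apply: (cut_edge_hexagon hx h).
Qed.

Lemma cut_set_edges : cut_set \subset edges e.
Proof.
apply/subsetP => r /cut_setP[u [z [c [y [q [f [_ /and5P[uz _ _ yq _] r_eq]]]]]]].
by rewrite inE; case: r_eq => ->.
Qed.

Lemma cut_set_acyclic : acyclic (del_edges e cut_set).
Proof.
apply: (cut_acyclic hx hexagon_in_cycle (i := i) (s := s)) => [x y|a b c d p q h aT].
  case/cut_setP=> u [z [c [y' [q [f [uT h r_eq]]]]]].
  have tu : tau u = i by move: uT; rewrite inE => /andP[_ /eqP].
  have [tz _ ty tq _] := tau_hexagon hx h; rewrite tu in tz ty tq.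
  by case: r_eq => -[-> ->].
have abE : (a, b) \in class_edges.
  by rewrite inE aT; apply/hexagon_edgeP; exists c, d, p, q.
by case: (cut_edge_hexagon hx h) => <-; [left|right]; apply: imset_f.
Qed.

Lemma beta_cut_set : beta e <= #|cut_set|.
Proof.
have [_ bmin] := betaP e; apply: bmin; apply/feedback_arc_setP; split.
  exact: cut_set_edges.
exact: cut_set_acyclic.
Qed.

Definition linked x y := ((x, y) \in class_edges) || ((y, x) \in class_edges).

Lemma linkedP x y : linked x y ->
  [/\ x \in tail_class, y \in head_class & (x, y) \in class_edges] \/
  [/\ x \in head_class, y \in tail_class & (y, x) \in class_edges].
Proof.
case/orP=> E; have := class_edges_head hx E; case/setIdP: (E) => /= xT _ yH.
  by left.
by right.
Qed.

Lemma tail_link x y : x \in tail_class -> linked x y -> (x, y) \in class_edges /\ y \in head_class.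
Proof. by move=> xT /linkedP[] [] // xH; case: (tail_head xT xH). Qed.

Lemma head_link x y : x \in head_class -> linked x y -> (y, x) \in class_edges /\ y \in tail_class.
Proof. by move=> xH /linkedP[] [] // xT; case: (tail_head xT xH). Qed.

Lemma path3_adj x0 x1 x2 x3 : linked x0 x1 -> linked x1 x2 -> linked x2 x3 ->
  e x0 x3 || e x3 x0.
Proof.
case/linkedP=> -[x0C x1C _].
  move=> /(head_link x1C)[_ x2C] /(tail_link x2C)[_ x3C].
  exact: (tail_head_adj hx x0C x3C).
move=> /(tail_link x1C)[_ x2C] /(head_link x2C)[_ x3C].
by rewrite orbC; apply: (tail_head_adj hx x3C x0C).
Qed.

(** The instance of [cross_sign] for the first and the last edge of the path. *)
Lemma path4_sign x0 x1 x2 x3 x4 :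
  linked x0 x1 -> linked x1 x2 -> linked x2 x3 -> linked x3 x4 ->
  ~~ linked x0 x3 -> ~~ linked x1 x4 -> e x0 x3 = e x1 x4.
Proof.
move=> l01 l12 l23 l34; rewrite !negb_or => /andP[n03 n30] /andP[n14 n41].
case/linkedP: l01 => -[x0C x1C x01].
  have [_ x2C] := head_link x1C l12; have [_ x3C] := tail_link x2C l23.
  by have [x43 _] := head_link x3C l34; apply: (cross_sign hx x01 x43).
have [_ x2C] := tail_link x1C l12; have [_ x3C] := head_link x2C l23.
by have [x34 _] := tail_link x3C l34; apply/esym/(cross_sign hx x01 x34).
Qed.

(* Otherwise the three edges of the path would lie in a common [square], and two
   of them would be distinct edges of the transversal with the same opposite edge. *)
Lemma cut_transversal_path3 (x0 x1 x2 x3 : V) : x0 != x2 -> x1 != x3 ->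
  (x0, x1) \in cut_transversal \/ (x1, x0) \in cut_transversal ->
  (x1, x2) \in cut_transversal \/ (x2, x1) \in cut_transversal ->
  linked x2 x3 -> ~~ linked x0 x3.
Proof.
move=> n02 n13 t01 t12 l23; apply/negP => l03.
have sub p : p \in cut_transversal -> p \in class_edges.
  exact: (subsetP (cut_transversal_sub e X tau i s)).
have sq u v z w : u != v -> z != w -> u \in tail_class -> v \in tail_class ->
    z \in head_class -> w \in head_class ->
    (u, z) \in class_edges -> (u, w) \in class_edges -> (v, z) \in class_edges ->
    (v, w) \in class_edges -> square e X tau u v z w.
  move=> uv zw uT vT zH wH uz uw vz vw; split=> //.
  - exact: (tail_same uT vT).
  - exact: (head_same zH wH).
  - by case/setIdP: uz => _; case/setIdP: uw => _; case/setIdP: vz => _; case/setIdP: vw.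
have key u v z w : square e X tau u v z w ->
    forall a b, (a, b) \in cut_transversal -> a \in [:: u; v] -> b \in [:: z; w] ->
    forall a' b', (a', b') \in cut_transversal -> a' \in [:: u; v] -> b' \in [:: z; w] ->
    (a, b) = (a', b').
  move=> sq_ a b tab aE bE a' b' tab' a'E b'E; apply: (cut_transversal_inj tab tab').
  have /setIdP[_ ab] := sub _ tab; have /setIdP[_ ab'] := sub _ tab'.
  exact: (square_cut_edge_eq hx sq_ aE bE a'E b'E ab ab').
have link t t' : (t, t') \in cut_transversal \/ (t', t) \in cut_transversal -> linked t t'.
  by case=> /sub tE; apply/orP; [left|right].
have in1 (a b : V) : a \in [:: a; b] by rewrite mem_head.
have in2 (a b : V) : b \in [:: a; b] by rewrite !inE eqxx orbT.
have l01 := link _ _ t01; have l12 := link _ _ t12.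
have Th a b : (a, b) \in cut_transversal -> a \in head_class -> False.
  by move=> /sub /setIdP[aT _] aH; case: (tail_head aT aH).
case/linkedP: (l01) => -[x0C x1C x01].
  have [x21 x2C] := head_link x1C l12; have [x23 x3C] := tail_link x2C l23.
  have [x03 _] := tail_link x0C l03.
  case: t01 => [t01|/Th/(_ x1C) //]; case: t12 => [/Th/(_ x1C) //|t12].
  have S := sq _ _ _ _ n02 n13 x0C x2C x1C x3C x01 x03 x21 x23.
  have [x02] := key _ _ _ _ S _ _ t01 (in1 _ _) (in1 _ _) _ _ t12 (in2 _ _) (in1 _ _).
  by rewrite x02 eqxx in n02.
have [x12 x2C] := tail_link x1C l12; have [x32 x3C] := head_link x2C l23.
have [x30 _] := head_link x0C l03.
case: t01 => [/Th/(_ x0C) //|t01]; case: t12 => [t12|/Th/(_ x2C) //].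
have S := sq _ _ _ _ n13 n02 x1C x3C x0C x2C x01 x12 x30 x32.
have [x02] := key _ _ _ _ S _ _ t01 (in1 _ _) (in1 _ _) _ _ t12 (in1 _ _) (in2 _ _).
by rewrite x02 eqxx in n02.
Qed.

(* Without a leaf there would be an infinite non-backtracking walk x along M; by
   [path4_sign] the edges between x n and x (n + 3) all point the same way, which
   gives an infinite walk in the acyclic digraph obtained by deleting [class_edges]. *)
Lemma cut_leaf (M : {set V * V}) : M \subset cut_transversal -> M != set0 ->
  exists x, #|[set p in M | (p.1 == x) || (p.2 == x)]| = 1.
Proof.
move=> sMT /set0Pn[p0 p0M].
have [/existsP[x /eqP]|] := boolP [exists x, #|[set p in M | (p.1 == x) || (p.2 == x)]| == 1].
  by exists x.
rewrite negb_exists => /forallP nleaf; exfalso.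
pose A x y := ((x, y) \in M) || ((y, x) \in M).
have ME p : p \in M -> p \in class_edges.
  by move=> pM; apply/(subsetP (cut_transversal_sub e X tau i s))/(subsetP sMT).
have AT x y : A x y -> (x, y) \in cut_transversal \/ (y, x) \in cut_transversal.
  by case/orP => /(subsetP sMT); [left|right].
have AL x y : A x y -> linked x y.
  by case/orP => /ME xyE; apply/orP; [left|right].
have ex_next x y : A x y -> exists z, A y z && (z != x).
  move=> xy; set N := [set p in M | (p.1 == y) || (p.2 == y)].
  pose p := if (x, y) \in M then (x, y) else (y, x).
  have pM : p \in M by rewrite /p; move: xy; rewrite /A; case: ifP.
  have pN : p \in N by rewrite inE pM /p; case: ifP; rewrite /= eqxx ?orbT.
  have /card_gt1P[q [q' [qN q'N qq']]] : 1 < #|N|.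
    by rewrite ltn_neqAle eq_sym nleaf card_gt0; apply/set0Pn; exists p.
  have [r rN rp] : exists2 r, r \in N & r != p.
    by have [qp|qp] := eqVneq q p; [exists q'; rewrite // -qp eq_sym | exists q].
  have antisym a b : (a, b) \in M -> (b, a) \in M -> False.
    move=> /ME abE /ME /setIdP[/= bT _].
    by apply: (tail_head bT); apply: (class_edges_head hx abE).
  case: r rN rp => r1 r2; rewrite inE /= => /andP[rM /orP[]/eqP ry] rp; subst y.
    exists r2; rewrite /A rM /=; apply: contraNneq rp => r2x; rewrite /p -r2x.
    by case: ifP => // /antisym; case.
  exists r1; rewrite /A rM orbT /=; apply: contraNneq rp => r1x; rewrite /p -r1x.
  by rewrite rM.
(* The default [xy.2] is never taken along the walk, because [ex_next] always supplies a
   candidate. *)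
pose nxt (xy : V * V) := odflt xy.2 [pick z | A xy.2 z && (z != xy.1)].
have nxtP x y : A x y -> A y (nxt (x, y)) && (nxt (x, y) != x).
  move=> xy; rewrite /nxt; case: pickP => //= none.
  by have [z] := ex_next _ _ xy; rewrite none.
pose w n := iter n (fun xy : V * V => (xy.2, nxt xy)) p0.
pose x n := (w n).1.
have xA n : A (x n) (x n.+1).
  suff : A (w n).1 (w n).2 by [].
  elim: n => [|n IH] /=; first by rewrite /A -surjective_pairing p0M.
  by case: (w n) IH => a b /= /nxtP/andP[].
have x2 n : x n != x n.+2.
  rewrite /x /=; have : A (w n).1 (w n).2 by apply: xA.
  by case: (w n) => a b /= /nxtP/andP[_]; rewrite eq_sym.
have xL n := AL _ _ (xA n).
have x3 n : ~~ linked (x n) (x n.+3).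
  exact: cut_transversal_path3 (x2 n) (x2 n.+1) (AT _ _ (xA n)) (AT _ _ (xA n.+1)) (xL n.+2).
have sgn n : e (x n) (x n.+3) = e (x 0) (x 3).
  elim: n => // n <-; apply/esym.
  exact: path4_sign (xL n) (xL n.+1) (xL n.+2) (xL n.+3) (x3 n) (x3 n.+1).
have x3E n : ((x n, x n.+3) \notin class_edges) && ((x n.+3, x n) \notin class_edges).
  by rewrite -negb_or; apply: x3.
have [fw|bw] := boolP (e (x 0) (x 3)).
  apply: (acyclic_no_walk (x := fun n => x (3 * n)) class_edges_acyclic) => n.
  by rewrite mulnS !addSn add0n /del_edges sgn fw; case/andP: (x3E (3 * n)).
apply: (acyclic_no_rev_walk (x := fun n => x (3 * n)) class_edges_acyclic) => n.
rewrite mulnS !addSn add0n /del_edges; case/andP: (x3E (3 * n)) => _ ->.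
have := path3_adj (xL (3 * n)) (xL _) (xL _).
by rewrite sgn (negbTE bw) /= andbT.
Qed.

(** By [cut_leaf] the transversal is a forest on the disjoint union of the two classes, and it has
    as many edges as the cut. *)
Lemma beta_class : tail_class != set0 -> beta e < #|tail_class| + #|head_class|.
Proof.
move=> T0; apply: leq_ltn_trans beta_cut_set _; rewrite -card_cut_transversal.
have -> : #|tail_class| + #|head_class| = #|tail_class :|: head_class|.
  rewrite cardsU; suff -> : tail_class :&: head_class = set0 by rewrite cards0 subn0.
  by apply/setP => x; rewrite !inE; case: (x \in X); case: s; rewrite /= ?andbF.
apply: forest_card cut_leaf.
  by apply: contraNneq T0 => U0; rewrite -subset0 -U0 subsetUl.
move=> p /(subsetP (cut_transversal_sub e X tau i s)) pE.
have pH := class_edges_head hx pE; case/setIdP: pE => pT _.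
rewrite !in_setU pT pH orbT /=; apply/eqP => p12.
by apply: (tail_head pT); rewrite p12.
Qed.

End CutSize.

(** * Strong vertex subsets and ears *)

Lemma connect_cross (V : finType) (r : rel V) (R : {pred V}) x y :
  connect r x y -> x \in R -> y \notin R -> exists a b, [/\ a \in R, b \notin R & r a b].
Proof.
case/connectP=> p; elim: p x => [|z p IH] x /= pth lst xR yR.
  by rewrite lst xR in yR.
case/andP: pth => rxz pth; have [zR|zR] := boolP (z \in R); last by exists x, z.
exact: IH zR yR.
Qed.

Lemma connect_cycle_through (V : finType) (r : rel V) x y :
  r x y -> connect r y x -> exists2 c, ucycle r c & c != [::].
Proof.
move=> rxy /connectP[p pth lst]; case: (shortenP pth) lst => p' pth' up' _ lst.
by exists (y :: p') => //; rewrite /ucycle /ucycleb up' andbT /= rcons_path pth' -lst.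
Qed.

Section StrongSubsets.

Variables (V : finType) (e : rel V) (X : {set V}).
Hypothesis ff : four_free_bip e X.
Implicit Types (U W A C : {set V}).

Let no4 := ff_no4 ff.

Definition within U : rel V := [rel x y | [&& x \in U, y \in U & e x y]].

Definition strong_in U : Prop := forall x y, x \in U -> y \in U -> connect (within U) x y.

Definition opp_side U x : {set V} := [set y in U | (x \in X) != (y \in X)].

Definition nonadj_deg x U : nat := #|[set y in U | nonadj e X x y]|.

(** Every nonadjacent pair inside [U] is counted twice; a bound of the number of pairs by [n - 3]
    thus becomes one of this sum by [2 * n - 6]. *)
Definition nonadj_sum U : nat := \sum_(x in U) nonadj_deg x U.

Lemma withinS U W x y : U \subset W -> within U x y -> within W x y.
Proof. by move=> /subsetP UW /and3P[/UW xW /UW yW xy]; apply/and3P. Qed.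

Lemma connect_withinS U W x y :
  U \subset W -> connect (within U) x y -> connect (within W) x y.
Proof. by move=> UW; apply: connect_sub => a b /(withinS UW)/connect1. Qed.

Lemma other_vertex U x : 1 < #|U| -> x \in U -> exists2 y, y \in U & y != x.
Proof.
move=> U1 xU; have : 0 < #|U :\ x| by move: U1; rewrite (cardsD1 x U) xU.
by case/card_gt0P=> y; rewrite !inE => /andP[yx yU]; exists y.
Qed.

Lemma out_neighbour U x : strong_in U -> 1 < #|U| -> x \in U -> exists2 y, y \in U & e x y.
Proof.
move=> sU U1 xU; have [y yU yx] := other_vertex U1 xU.
have [|a [b [/eqP -> _ /and3P[_ bU xb]]]] := @connect_cross _ _ (pred1 x) _ _ (sU _ _ xU yU) (eqxx x).
  exact: yx.
by exists b.
Qed.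

Lemma in_neighbour U x : strong_in U -> 1 < #|U| -> x \in U -> exists2 y, y \in U & e y x.
Proof.
move=> sU U1 xU; have [y yU yx] := other_vertex U1 xU.
have := @connect_cross _ _ (predC1 x) _ _ (sU _ _ yU xU) yx.
case=> [|a [b [_ ]]]; first by rewrite inE /= eqxx.
by rewrite inE /= negbK => /eqP -> /and3P[aU _ ax]; exists a.
Qed.

Lemma cycle_strong (c : seq V) : cycle e c -> strong_in [set x in c].
Proof.
move=> cyc x y; rewrite !inE => xc yc.
apply: (connect_cycle (p := c)) => //; apply: (@sub_in_cycle _ [in c]) cyc => //.
  by move=> a b ac bc ab; apply/and3P; rewrite !inE.
Qed.

(** [C] is the vertex set of a shortest cycle inside [U], of length [2 * k]. It has no chords, so
    each vertex is nonadjacent to all but two of the [k] vertices across; 4-freeness excludes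
    [k < 3]. *)
Lemma short_cycle U : strong_in U -> 1 < #|U| -> exists C k,
  [/\ C \subset U, strong_in C, #|C| = k.*2 &
   [/\ 3 <= k, forall x, k <= #|opp_side C x|, (k.*2 * (k - 2) <= nonadj_sum C)
   & k = 3 -> exists a b c d p q, hexagon e a b c d p q /\ all (mem U) [:: a; b; c; d; p; q]]].
Proof.
move=> sU U1; have [x0 x0U] : exists x, x \in U by apply/card_gt0P; apply: ltnW.
have [y0 y0U xy0] := out_neighbour sU U1 x0U.
have [c0 uc0 nc0] : exists2 c, ucycle (within U) c & c != [::].
  apply: (connect_cycle_through (x := x0) (y := y0)); last exact: sU.
  by apply/and3P.
have [c [/andP[cyc uc] nc chord]] := chordless_cycle uc0 nc0.
pose C := [set x in c].
have cE : cycle e c by apply: sub_cycle cyc => x y /and3P[].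
have nextc x : x \in c -> within U x (next c x) by move=> xc; apply: next_cycle.
have cU x : x \in c -> x \in U by move=> /nextc /and3P[].
have nexte x : x \in c -> e x (next c x) by move=> /nextc /and3P[].
have out x y : x \in c -> y \in c -> e x y -> y = next c x.
  by move=> xc yc xy; apply: chord => //; apply/and3P; split=> //; apply: cU.
have inj : injective (next c) by apply: can_inj (prev_next uc).
(* The successor map sends each side injectively into the other, so both sides have equally many
   vertices. *)
have card_le b : #|[set x in C | (x \in X) == b]| <= #|[set x in C | (x \in X) == ~~ b]|.
  rewrite -(card_imset _ inj); apply: subset_leq_card; apply/subsetP => _ /imsetP[x + ->].
  rewrite !inE mem_next => /andP[xc /eqP <-]; rewrite xc /=.
  by rewrite (side_neq ff (nexte x xc)) negbK.
pose k := #|[set x in C | (x \in X) == true]|.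
have kf : #|[set x in C | (x \in X) == false]| = k.
  by apply/eqP; rewrite eqn_leq card_le /k; apply: (card_le true).
have cardC : #|C| = k.*2.
  rewrite -addnn -{2}kf /k -cardsUI.
  have -> : [set x in C | (x \in X) == true] :&: [set x in C | (x \in X) == false] = set0.
    by apply/setP => x; rewrite !inE; case: (x \in X); rewrite ?andbF.
  rewrite cards0 addn0; apply: eq_card => x; rewrite !inE.
  by case: (x \in X); case: (x \in c).
have szc : size c = k.*2 by rewrite -cardC /C cardsE; apply/esym/card_uniqP.
have oppk x : #|opp_side C x| = k.
  rewrite /opp_side; case xX: (x \in X).
    by rewrite -kf; apply: eq_card => y; rewrite !inE; case: (y \in X).
  by rewrite /k; apply: eq_card => y; rewrite !inE; case: (y \in X).
have k3 : 3 <= k.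
  case: k szc {kf cardC oppk} => [|[|[|//]]].
  - by move/size0nil => c_nil; rewrite c_nil in nc.
  - case: c cE {nc cyc uc chord C cU nextc nexte out inj card_le} => [|a [|b []]] //= /and3P[ab ba _] _.
    by have := ff_no2 ff ab; rewrite ba.
  - case: c cE {nc cyc uc chord C cU nextc nexte out inj card_le} => [|a [|b [|d [|p []]]]] //= /and5P[ab bd dp pa _] _.
    by case: (no4 ab bd dp pa).
have CU : C \subset U by apply/subsetP => x; rewrite inE => /cU.
exists C, k; split=> //; first exact: cycle_strong.
split=> //.
- by move=> x; rewrite oppk.
- rewrite -cardC /nonadj_sum -sum_nat_const; apply: leq_sum => x; rewrite inE => xc.
  rewrite -(oppk x) /nonadj_deg leq_subLR.
  apply: (@leq_trans (#|[set next c x; prev c x]| + #|[set y in C | nonadj e X x y]|)); last first.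
    by rewrite leq_add2r cards2; case: (_ != _).
  apply: leq_trans (leq_card_setU _ _); apply: subset_leq_card.
  apply/subsetP => y; rewrite !inE => /andP[yc sxy]; rewrite yc /nonadj /= sxy /=.
  have [xy|] := boolP (e x y); first by rewrite (out _ _ xc yc xy) eqxx.
  have [yx|] := boolP (e y x); last by rewrite /= orbT.
  by rewrite (out _ _ yc xc yx) prev_next // eqxx orbT.
- move=> k3'; rewrite k3' in szc.
  case: c szc cE cU {nc cyc uc chord C cardC CU card_le k kf k3 k3' oppk nextc nexte out inj}
    => [|a [|b [|d [|p [|q [|f []]]]]]] //= _ /and5P[ab bd dp pq /and3P[qf fa _]] cU.
  exists a, b, d, p, q, f; split; first by apply/and5P; split=> //; apply/andP.
  by rewrite !cU // !inE eqxx ?orbT.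
Qed.

End StrongSubsets.

(** * Extending strong subsets along shortest ears *)

Section Ears.

Variables (V : finType) (e : rel V) (X : {set V}).
Hypothesis ff : four_free_bip e X.
Implicit Types (U W A C P : {set V}).

Let no4 := ff_no4 ff.
Local Notation strong_in := (strong_in e).
Local Notation within := (within e).
Local Notation nonadj_deg := (nonadj_deg e X).
Local Notation nonadj_sum := (nonadj_sum e X).
Local Notation opp_side := (opp_side X).

Lemma opp_side_card U x : strong_in U -> 1 < #|U| -> 3 <= #|opp_side U x|.
Proof.
move=> sU U1; have [C [k [/subsetP CU _ _ [k3 /(_ x) kx _ _]]]] := short_cycle ff sU U1.
apply: leq_trans k3 (leq_trans kx _); apply: subset_leq_card; apply/subsetP => y.
by rewrite !inE => /andP[/CU -> ->].
Qed.

(** Let [R] hold what [v] reaches in one or two steps. It contains [a] but not [b], so an edge from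
    [p] to [y] in [U] leaves it. Then [p] is two steps from [v], and an edge between [v] and [y]
    would put [y] into [R] or close a directed 4-cycle. *)
Lemma three_step U v a b : strong_in U -> a \in U -> b \in U -> e v a -> e b v ->
  exists a' p y, [/\ e v a', e a' p, e p y & y \in U /\ nonadj e X v y].
Proof.
move=> sU aU bU va bv.
pose R := [pred u | e v u || [exists a', e v a' && e a' u]].
have bR : b \notin R.
  rewrite inE /= negb_or (ff_no2 ff bv) /=; apply/existsP => -[a' /andP[va' a'b]].
  have := side_neq ff va'; rewrite (side_neq ff a'b) -(negbK (v \in X)) -(side_neq ff bv).
  by case: (b \in X).
have aR : a \in R by rewrite inE /= va.
have [p [y [pR yR /and3P[pU yU py]]]] := connect_cross (sU _ _ aU bU) aR bR.
move: yR; rewrite inE /= negb_or => /andP[nvy ny].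
move: pR; rewrite inE /= => /orP[vp|/existsP[a' /andP[va' a'p]]].
  by case/existsP: ny; exists p; rewrite vp.
exists a', p, y; split=> //; split=> //; apply/and3P; split=> //.
  by rewrite (side_neq ff va') (side_neq ff a'p) (side_neq ff py) negbK; case: (y \in X).
by apply/negP => yv; apply: (no4 va' a'p py yv).
Qed.

(** The argument of [three_step] in the reversed direction: [R] is the complement of the vertices
    that reach [v] in one or two steps. *)
Lemma three_step_back U v a b : strong_in U -> a \in U -> b \in U -> e v a -> e b v ->
  exists b' q y, [/\ e b' v, e q b', e y q & y \in U /\ nonadj e X v y].
Proof.
move=> sU aU bU va bv.
pose R := [pred u | ~~ (e u v || [exists b', e u b' && e b' v])].
have bR : b \notin R by rewrite inE /= negbK bv.
have aR : a \in R.
  rewrite inE /= negb_or (ff_no2 ff va) /=; apply/existsP => -[b' /andP[ab' b'v]].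
  have := side_neq ff ab'; rewrite (side_neq ff b'v) (side_neq ff va).
  by case: (a \in X).
have [y [q [yR qR /and3P[yU qU yq]]]] := connect_cross (sU _ _ aU bU) aR bR.
move: yR; rewrite inE /= negb_or => /andP[nyv ny].
move: qR; rewrite inE /= negbK => /orP[qv|/existsP[b' /andP[qb' b'v]]].
  by case/existsP: ny; exists q; rewrite yq.
exists b', q, y; split=> //; split=> //; apply/and3P; split=> //.
  by rewrite eq_sym (side_neq ff yq) (side_neq ff qb') (side_neq ff b'v) negbK; case: (v \in X).
by apply/negP => vy; apply: (no4 vy yq qb' b'v).
Qed.

(* Otherwise h and l would each miss a single vertex y, x of U, and every b after
   l and a before h would satisfy b -> y -> x -> a; then a has no out-neighbour. *)
Lemma two_step U h l a b : strong_in U -> 1 < #|U| -> h \notin U -> l \notin U -> e h l ->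
  a \in U -> e a h -> b \in U -> e l b ->
  (forall u, u \in U -> ~~ e h u) -> (forall u, u \in U -> ~~ e u l) ->
  3 <= nonadj_deg h U + nonadj_deg l U.
Proof.
move=> sU U1 hU lU hl aU ah bU lb nhU nUl.
have side := side_neq ff.
have sl : (l \in X) = ~~ (h \in X) by rewrite (side _ _ hl) negbK.
have hN u : u \in U -> (u \in X) = ~~ (h \in X) -> ~~ e u h -> nonadj e X h u.
  by move=> uU su nuh; apply/and3P; split; rewrite ?nhU // su; case: (h \in X).
have lN u : u \in U -> (u \in X) = (h \in X) -> ~~ e l u -> nonadj e X l u.
  by move=> uU su nlu; apply/and3P; split; rewrite ?nUl // sl su; case: (h \in X).
have afterb b' u : b' \in U -> e l b' -> u \in U -> e b' u -> nonadj e X h u.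
  move=> b'U lb' uU b'u; apply: hN => //.
    by rewrite -sl (side _ _ lb') (side _ _ b'u) negbK.
  by apply/negP => uh; apply: (no4 uh hl lb' b'u).
have beforea a' u : a' \in U -> e a' h -> u \in U -> e u a' -> nonadj e X l u.
  move=> a'U a'h uU ua'; apply: lN => //.
    by rewrite (side _ _ ua') (side _ _ a'h) negbK.
  by apply/negP => lu; apply: (no4 lu ua' a'h hl).
have [y yU b_y] := out_neighbour sU U1 bU.
have [x xU x_a] := in_neighbour sU U1 aU.
have hy := afterb _ _ bU lb yU b_y; have lx := beforea _ _ aU ah xU x_a.
rewrite leqNgt; apply/negP => lt3.
have h0 : 0 < nonadj_deg h U by apply/card_gt0P; exists y; rewrite inE yU.
have l0 : 0 < nonadj_deg l U by apply/card_gt0P; exists x; rewrite inE xU.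
have [hle1 lle1] : nonadj_deg h U <= 1 /\ nonadj_deg l U <= 1.
  by move: (nonadj_deg h U) (nonadj_deg l U) lt3 h0 l0; clear; lia.
have h1 u : u \in U -> nonadj e X h u -> u = y.
  by move=> uU hu; apply: (card_le1_eqP hle1); rewrite inE ?uU ?yU.
have l1 u : u \in U -> nonadj e X l u -> u = x.
  by move=> uU lu; apply: (card_le1_eqP lle1); rewrite inE ?uU ?xU.
have toy b' : b' \in U -> e l b' -> e b' y.
  move=> b'U lb'; have [u uU b'u] := out_neighbour sU U1 b'U.
  by rewrite -(h1 _ uU (afterb _ _ b'U lb' uU b'u)).
have sy : (y \in X) = ~~ (h \in X) by rewrite -sl (side _ _ lb) (side _ _ b_y) negbK.
have yx : e y x.
  have [u uU yu] := out_neighbour sU U1 yU.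
  have su : (u \in X) = (h \in X) by move: sy; rewrite (side _ _ yu); case: (u \in X); case: (h \in X).
  have [lu|nlu] := boolP (e l u); last by rewrite -(l1 u uU (lN _ uU su nlu)).
  by have := ff_no2 ff yu; rewrite toy.
have [u uU au] := out_neighbour sU U1 aU.
have su : (u \in X) = (h \in X).
  by have := side _ _ ah; rewrite (side _ _ au); case: (u \in X); case: (h \in X).
have [lu|nlu] := boolP (e l u); first by apply: (no4 (toy _ uU lu) yx x_a au).
by have := ff_no2 ff x_a; rewrite -{1}(l1 u uU (lN _ uU su nlu)) au.
Qed.

(** Pairs between [U] and [P] are counted from both ends; pairs inside [P] are dropped. *)
Lemma nonadj_sumU U P : [disjoint U & P] ->
  nonadj_sum U + 2 * \sum_(p in P) nonadj_deg p U <= nonadj_sum (U :|: P).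
Proof.
move=> dUP; have degU x : nonadj_deg x (U :|: P) = nonadj_deg x U + nonadj_deg x P.
  rewrite /nonadj_deg -cardsUI.
  have -> : [set y in U | nonadj e X x y] :&: [set y in P | nonadj e X x y] = set0.
    apply/setP => y; rewrite !inE; case yU: (y \in U) => //=.
    by rewrite (disjointFr dUP yU) andbF.
  rewrite cards0 addn0; apply: eq_card => y; rewrite !inE.
  by case: (nonadj e X x y); rewrite ?andbT ?andbF.
have sym : \sum_(x in U) nonadj_deg x P = \sum_(p in P) nonadj_deg p U.
  have E Q x : nonadj_deg x Q = \sum_(y in Q) nonadj e X x y.
    by rewrite /nonadj_deg -sum1dep_card big_mkcondr; apply: eq_bigr => y _; case: (nonadj _ _ _ _).
  under eq_bigr do rewrite E; rewrite exchange_big; apply: eq_bigr => p _ /=.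
  by rewrite E; apply: eq_bigr => u _; rewrite nonadj_sym.
have -> : nonadj_sum (U :|: P) =
    nonadj_sum U + \sum_(x in U) nonadj_deg x P + \sum_(p in P) nonadj_deg p (U :|: P).
  have -> : nonadj_sum (U :|: P) = \sum_(x in [predU U & P]) nonadj_deg x (U :|: P).
    by apply: eq_bigl => x; rewrite !inE.
  by rewrite bigU //= (eq_bigr _ (fun x _ => degU x)) big_split.
rewrite sym mul2n -addnn addnA leq_add2l; apply: leq_sum => p _.
by rewrite degU leq_addr.
Qed.

Section Ear.

Variables A U : {set V}.
Hypotheses (sA : strong_in A) (sU : strong_in U) (U1 : 1 < #|U|) (UA : U \proper A).

Definition enters v := [exists u in U, e u v].
Definition leaves v := [exists u in U, e v u].

Definition ear (s : seq V) : bool :=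
  if s is h :: t then
    [&& all [in A :\: U] s, uniq s, path e h t, enters h & leaves (last h t)]
  else false.

Lemma ear_exists : exists s, ear s.
Proof.
have [x xA xU] : exists2 x, x \in A & x \notin U by case/properP: UA.
have [u uU] : exists u, u \in U by apply/card_gt0P; apply: ltnW.
have uA : u \in A by apply: (subsetP (proper_sub UA)).
have [a [h [aU hU /and3P[aA hA ah]]]] := connect_cross (sA uA xA) uU xU.
(* Follow a path from [h] back to [U] and stop before its first vertex in [U]. *)
have /connectP[p0 pth0 lst0] := sA hA uA.
case: (shortenP pth0) lst0 => p pth up _ lst.
have hp : has [in U] p.
  apply/hasP; exists u => //; move: uU; rewrite lst => lU.
  by have := mem_last h p; rewrite inE => /predU1P[lh|//]; rewrite lh in lU; rewrite lU in hU.
case: (split_find hp) pth up => y s1 s2 yU s1U; rewrite -cats1 -catA cat_path /= => /and3P[pth1 sy _].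
rewrite mem_cat cat_uniq negb_or => /andP[/andP[hs1 _] /and3P[us1 _ _]].
exists (h :: s1) => /=; rewrite inE hU hA hs1 us1 /=.
have s1A : all [in A :\: U] s1.
  apply/allP => z zs1; rewrite !inE; apply/andP; split.
    by apply: contra s1U => zU; apply/hasP; exists z.
  have := path_connect pth1 (_ : z \in h :: s1); rewrite inE zs1 orbT => /(_ isT).
  case/connectP=> q; elim/last_ind: q => [_ ->//|q w _].
  by rewrite rcons_path last_rcons => /andP[_ /and3P[_ wA _]] ->.
rewrite s1A /=; apply/and3P; split.
- by apply: sub_path pth1 => z w /and3P[].
- by apply/existsP; exists a; rewrite aU.
- by apply/existsP; exists y; rewrite yU; case/and3P: sy.
Qed.

Lemma ear_strong s : ear s -> strong_in (U :|: [set x in s]).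
Proof.
case: s => // h t /and5P[_ _ pth /existsP[u0 /andP[u0U u0h]] /existsP[u1 /andP[u1U lu1]]].
set W := _ :|: _.
have sW x : x \in h :: t -> x \in W by move=> xs; rewrite !inE -in_cons xs orbT.
have uW x : x \in U -> x \in W by move=> xU; rewrite inE xU.
have pthW : path (within W) h t.
  have allW : all [in W] (h :: t) by apply/allP.
  by apply: (sub_in_path (P := [in W])) pth => // a b aW bW ab; apply/and3P.
have into x : x \in W -> exists2 u, u \in U & connect (within W) u x.
  rewrite !inE => /orP[xU|xs]; first by exists x.
  exists u0 => //; apply: (@connect_trans _ _ h); last exact: (path_connect pthW).
  by apply: connect1; apply/and3P; rewrite uW // sW ?mem_head.
have outof x : x \in W -> exists2 u, u \in U & connect (within W) x u.
  rewrite !inE => /orP[xU|xs]; first by exists x.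
  exists u1 => //; apply: (@connect_trans _ _ (last h t)); last first.
    by apply: connect1; apply/and3P; split; [apply/sW/mem_last | exact: uW |].
  have xs' : x \in h :: t by rewrite inE.
  case/splitPl: xs' pthW => p1 p2 lx; rewrite cat_path lx => /andP[_ pth2].
  by apply/connectP; exists p2; rewrite // last_cat lx.
move=> x y xW yW; have [u uU xu] := outof x xW; have [v vU vy] := into y yW.
apply: connect_trans xu (connect_trans _ vy).
by apply: (connect_withinS (subsetUl U _)); apply: sU.
Qed.

(** Add a shortest ear. A single vertex has a nonneighbour in [U] by [three_step], and two vertices
    have three by [two_step]. On a longer ear an inner vertex adjacent to [U] would give a shorter
    ear, so it misses all of the at least three vertices across. *)
Lemma ear_extension : exists W, [/\ U \proper W, W \subset A, strong_in W &
  (exists v, [/\ v \notin U, W = v |: U & 0 < nonadj_deg v U]) \/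
  nonadj_sum U + 2 * (#|W| - #|U|) < nonadj_sum W].
Proof.
pose P n := [exists t : n.-tuple V, ear t].
have exP : exists n, P n.
  by have [s es] := ear_exists; exists (size s); apply/existsP; exists (in_tuple s).
case: (ex_minnP exP) => n /existsP[[s /= /eqP szs] es] minn.
have min s' : ear s' -> size s <= size s'.
  by move=> es'; rewrite szs; apply: minn; apply/existsP; exists (in_tuple s').
pose Q := [set x in s]; have sW := ear_strong es.
case: s szs es min sW @Q => // h t szs es min sW Q.
have /and5P[/allP sAU us pth hin lout] := es.
have sU' x : x \in h :: t -> (x \in A) /\ (x \notin U).
  by move/sAU; rewrite !inE => /andP[].
have dUQ : [disjoint U & Q].
  rewrite disjoint_sym disjoint_subset; apply/subsetP => x; rewrite !inE -in_cons.
  by case/sU'.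
have cW : #|U :|: Q| - #|U| = size (h :: t).
  rewrite cardsU disjoint_setI0 // cards0 subn0 addKn cardsE.
  exact/card_uniqP.
have sumQ : \sum_(p in Q) nonadj_deg p U = \sum_(p <- h :: t) nonadj_deg p U.
  by rewrite (big_uniq _ us); apply: eq_bigl => x; rewrite inE.
have := nonadj_sumU dUQ; rewrite sumQ => grow.
exists (U :|: Q); split=> //.
- apply/properP; split; first exact: subsetUl.
  by exists h; rewrite ?inE ?eqxx ?orbT //; case: (sU' h (mem_head _ _)).
- rewrite subUset (proper_sub UA); apply/subsetP => x; rewrite inE => xs.
  by case: (sU' x xs).
case: t => [|x t] in szs es min sW Q sAU us pth hin lout sU' dUQ cW sumQ grow *.
  left; exists h; split; first by case: (sU' h (mem_head _ _)).
    by rewrite setUC; congr (_ :|: _); apply/setP => x; rewrite !inE.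
  case/existsP: hin => b /andP[bU bh]; case/existsP: lout => a /andP[aU ha].
  have [a' [p [y [_ _ _ [yU hy]]]]] := three_step sU aU bU ha bh.
  by apply/card_gt0P; exists y; rewrite inE yU.
right; rewrite cW; apply: leq_trans grow; rewrite -addnS leq_add2l.
suff : size [:: h, x & t] < \sum_(p <- [:: h, x & t]) nonadj_deg p U by lia.
have single v : v \in [:: h, x & t] -> enters v -> leaves v -> False.
  by move=> vs vin vout; have := min [:: v]; rewrite /= vin vout (sAU v vs) => /(_ isT).
have hs : h \in [:: h, x & t] by rewrite mem_head.
have nhU u : u \in U -> ~~ e h u.
  move=> uU; apply/negP => hu; apply: (single h) => //.
  by apply/existsP; exists u; rewrite uU.
case: t => [|y t] in szs es min sW Q sAU us pth hin lout sU' dUQ cW sumQ single hs *.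
  rewrite big_cons big_cons big_nil addn0.
  case/existsP: hin => a /andP[aU ah]; case/existsP: lout => b /andP[bU /= xb].
  have xs : x \in [:: h; x] by rewrite !inE eqxx orbT.
  have [[_ hU] [_ xU]] := (sU' h hs, sU' x xs).
  move: pth => /= /andP[hx _].
  apply: (two_step sU U1 hU xU hx aU ah bU xb nhU) => u uU; apply/negP => ux.
  by apply: (single x) => //; apply/existsP; [exists u; rewrite uU | exists b; rewrite bU].
have split_size s1 z s2 : [:: x, y & t] = s1 ++ z :: s2 ->
    size [:: h, x, y & t] = size s1 + (size s2).+2.
  by move=> /(congr1 size); rewrite size_cat /= => ->; rewrite [RHS]addnS.
have not_enters s1 z s2 : [:: x, y & t] = s1 ++ z :: s2 -> ~~ enters z.
  move=> def_s; apply/negP => zin; suff /min : ear (z :: s2).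
    by rewrite (split_size _ _ _ def_s) addnS ltnNge leq_addl.
  move: pth us lout; rewrite def_s cat_path last_cat -cat_cons cat_uniq /=.
  move=> /and3P[_ _ pth'] /and3P[_ _ us'] lout'.
  have allz : all [in A :\: U] (z :: s2).
    by apply/allP => w ws; apply: sAU; rewrite inE def_s mem_cat ws !orbT.
  by apply/and5P; split.
have not_leaves s1 z s2 : [:: x, y & t] = s1 ++ z :: s2 -> s2 != [::] -> ~~ leaves z.
  move=> def_s s20; apply/negP => zout; suff /min : ear (h :: rcons s1 z).
    rewrite (split_size _ _ _ def_s) /= size_rcons !addnS !ltnS.
    by rewrite -[X in _ <= X]addn0 leq_add2l leqn0 size_eq0 (negbTE s20).
  move: pth us; rewrite def_s -cat_rcons cat_path -cat_cons cat_uniq.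
  move=> /andP[pth' _] /and3P[us' _ _].
  have alls : all [in A :\: U] (h :: rcons s1 z).
    apply/allP => w ws; apply: sAU; rewrite inE def_s -cat_rcons mem_cat.
    by move: ws; rewrite inE => /predU1P[->|->]; rewrite ?eqxx ?orbT.
  by apply/and5P; split=> //; rewrite last_rcons.
have mid z : z \in belast x (y :: t) -> 3 <= nonadj_deg z U.
  move=> zm; have [s1 [s2 def_s]] : exists s1 s2, [:: x, y & t] = s1 ++ z :: rcons s2 (last y t).
    rewrite lastI; case/splitPr: zm => s1 s2; exists s1, s2.
    by rewrite rcons_cat.
  have nz : ~~ enters z := not_enters _ _ _ def_s.
  have zl : ~~ leaves z by apply: (not_leaves _ _ _ def_s); rewrite -size_eq0 size_rcons.
  apply: leq_trans (opp_side_card z sU U1) _; apply: subset_leq_card; apply/subsetP => u.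
  rewrite !inE => /andP[uU szu]; rewrite uU /nonadj /= szu /=; apply/andP; split.
    by apply: contra zl => zu; apply/existsP; exists u; rewrite uU.
  by apply: contra nz => uz; apply/existsP; exists u; rewrite uU.
rewrite big_cons (lastI x (y :: t)) big_rcons /=.
have sum_mid : 3 * (size t).+1 <= \sum_(p <- belast x (y :: t)) nonadj_deg p U.
  rewrite -[(size t).+1](size_belast x (y :: t)).
  elim: (belast x (y :: t)) mid => [|z m IH] midm; first by rewrite big_nil.
  rewrite big_cons /= mulnS leq_add ?midm ?mem_head // IH // => w wm.
  by apply: midm; rewrite inE wm orbT.
(* With [m] vertices on the ear, the inner ones contribute at least [3 * (m - 2)], which exceeds [m]
   once [m] is at least 4. For [m = 3] the missing unit comes from [h]. *)
suff hpos : t = [::] -> 0 < nonadj_deg h U.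
  have {}hpos : size t = 0 -> 0 < nonadj_deg h U by move/size0nil.
  rewrite /= size_rcons -/(belast x (y :: t)) size_belast /=.
  move: sum_mid hpos; rewrite [belast x (y :: t)]/=.
  move: (\sum_(p <- _) _) (nonadj_deg h U) (nonadj_deg _ U) (size t); clear; lia.
move=> t0; move: pth lout; rewrite t0 /= => /and3P[hx xy _] /existsP[u /andP[uU yu]].
apply/card_gt0P; exists u; rewrite inE uU /nonadj /= nhU //=; apply/andP; split.
  by rewrite (side_neq ff hx) (side_neq ff xy) (side_neq ff yu) negbK; case: (u \in X).
by apply/negP => uh; apply: (no4 hx xy yu uh).
Qed.

End Ear.

End Ears.

(** * Tight digraphs *)

Section Tight.

Variables (V : finType) (e : rel V) (X : {set V}).
Hypothesis ff : four_free_bip e X.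
Implicit Types (U W A C P : {set V}).

Let no4 := ff_no4 ff.
Local Notation strong_in := (strong_in e).
Local Notation nonadj_deg := (nonadj_deg e X).
Local Notation nonadj_sum := (nonadj_sum e X).

Lemma nonadj_sumU1 U v : v \notin U ->
  nonadj_sum U + 2 * nonadj_deg v U <= nonadj_sum (v |: U).
Proof.
move=> vU; rewrite setUC; apply: leq_trans (nonadj_sumU _ _ _); rewrite ?big_set1 //.
by rewrite disjoint_sym disjoints1.
Qed.

(** The excess [nonadj_sum U - 2 * #|U|] does not drop along ear extensions. *)
Lemma strong_excess A U : strong_in A -> strong_in U -> 1 < #|U| -> U \subset A ->
  nonadj_sum U + 2 * #|A| <= nonadj_sum A + 2 * #|U|.
Proof.
move=> sA; have [n] := ubnP (#|A| - #|U|); elim: n U => // n IH U leUn sU U1 UA.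
have [->//|UnA] := eqVneq U A.
have pUA : U \proper A by rewrite properEneq UnA.
have [W [pUW WA sW Wcase]] := ear_extension ff sA sU U1 pUA.
have leUW := proper_card pUW; have leWA := subset_leq_card WA.
have gain : nonadj_sum U + 2 * (#|W| - #|U|) <= nonadj_sum W.
  case: Wcase => [[v [vU -> v0]]|]; last by move/ltnW.
  by apply: leq_trans (nonadj_sumU1 vU); rewrite cardsU1 vU add1n subSnn; lia.
have := IH W _ sW (leq_trans U1 (ltnW leUW)) WA; lia.
Qed.

(** Start from a shortest cycle: [2 * k * (k - 2) + 6] is at least [4 * k] for [k] at least 3, with
    equality at [k = 3]. *)
Lemma strong_lower U : strong_in U -> 1 < #|U| -> 2 * #|U| <= nonadj_sum U + 6.
Proof.
move=> sU U1; have [C [k [CU sC cC [k3 _ leC _]]]] := short_cycle ff sU U1.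
have := strong_excess sU sC _ CU; rewrite cC => /(_ ltac:(lia)).
have : 4 * k <= k.*2 * (k - 2) + 6 by nia.
lia.
Qed.

Hypothesis sV : strong_in [set: V].
Hypothesis tight : nonadj_sum [set: V] + 6 <= 2 * #|V|.

(** The excess of [U] lies between the general lower bound and that of the whole digraph, which
    coincide. *)
Lemma tight_strong U : strong_in U -> 1 < #|U| -> nonadj_sum U + 6 = 2 * #|U|.
Proof.
move=> sU U1; have := strong_excess sV sU U1 (subsetT _); rewrite cardsT.
have := strong_lower sU U1; lia.
Qed.

(** Equality for the shortest cycle of [U] forces [k = 3]. *)
Lemma tight_hexagon U : strong_in U -> 1 < #|U| ->
  exists a b c d p q, hexagon e a b c d p q /\ all [in U] [:: a; b; c; d; p; q].
Proof.
move=> sU U1; have [C [k [CU sC cC [k3 _ leC hexC]]]] := short_cycle ff sU U1.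
apply: hexC; have := tight_strong sC _; rewrite cC => /(_ ltac:(lia)).
nia.
Qed.

(** Every strong subset attains equality, so the ear adds exactly one nonadjacent pair per vertex.
    This excludes the strict alternative of [ear_extension] and a second nonneighbour of [v]. *)
Lemma leaf_extension U : strong_in U -> 1 < #|U| -> U != [set: V] -> exists v w,
  [/\ v \notin U, w \in U, strong_in (v |: U), nonadj e X v w &
      forall u, u \in U -> nonadj e X v u -> u = w].
Proof.
move=> sU U1 UT; have pUT : U \proper [set: V] by rewrite properEneq UT subsetT.
have [W [pUW WA sW Wcase]] := ear_extension ff sV sU U1 pUT.
have leUW := proper_card pUW.
have tU := tight_strong sU U1; have tW := tight_strong sW (leq_trans U1 (ltnW leUW)).
case: Wcase => [[v [vU defW v0]]|]; last by lia.
have v1 : nonadj_deg v U <= 1.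
  by have := nonadj_sumU1 vU; rewrite -defW; move: tW; rewrite defW cardsU1 vU; lia.
have /card_gt0P[w] := v0; rewrite inE => /andP[wU vw]; exists v, w; split=> //.
  by rewrite -defW.
move=> u uU vu; move: v1 => /card_le1_eqP; apply; by rewrite inE ?uU ?wU.
Qed.

(** Repeated leaf extension exhausts the digraph, so properties spread from any strong subset, in
    practice a hexagon, to all vertices. *)
Lemma leaf_ind (P : {set V} -> Prop) U0 : strong_in U0 -> 1 < #|U0| -> P U0 ->
  (forall U v w, strong_in U -> 1 < #|U| -> v \notin U -> w \in U -> strong_in (v |: U) ->
     nonadj e X v w -> (forall u, u \in U -> nonadj e X v u -> u = w) -> P U -> P (v |: U)) ->
  P [set: V].
Proof.
move=> sU0 U01 PU0 step; have [n] := ubnP (#|V| - #|U0|).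
elim: n U0 sU0 U01 PU0 => // n IH U sU U1 PU leUn.
have [<-//|UT] := eqVneq U [set: V].
have [v [w [vU wU sW vw uniq_w]]] := leaf_extension sU U1 UT.
have cW : #|v |: U| = #|U|.+1 by rewrite cardsU1 vU.
apply: (IH (v |: U)) => //; first by rewrite cW; apply: ltnW.
  exact: (step U v w).
have := max_card [in v |: U]; rewrite cW in leUn *; lia.
Qed.

(** Three steps forward from [v] and three steps backward both end at a nonneighbour of [v] in [U],
    hence at [w]; the two paths form a hexagon. *)
Lemma leaf_hexagon U v w : strong_in U -> strong_in (v |: U) -> 1 < #|U| -> v \notin U ->
  (forall u, u \in U -> nonadj e X v u -> u = w) ->
  exists a p q b, hexagon e v a p w q b.
Proof.
move=> sU sW U1 vU uniq_w; have vW : v \in v |: U by rewrite !inE eqxx.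
have W1 : 1 < #|v |: U| by rewrite cardsU1 vU; apply: ltnW.
have loop x : e x x = false by apply/negP => xx; have := ff_no2 ff xx; rewrite xx.
have [a aW va] := out_neighbour sW W1 vW; have [b bW bv] := in_neighbour sW W1 vW.
have aU : a \in U by move: aW; rewrite !inE => /predU1P[av|//]; rewrite av loop in va.
have bU : b \in U by move: bW; rewrite !inE => /predU1P[bv'|//]; rewrite bv' loop in bv.
have [a' [p [y [va' a'p py [yU vy]]]]] := three_step ff sU aU bU va bv.
have [b' [q [z [b'v qb' zq [zU vz]]]]] := three_step_back ff sU aU bU va bv.
exists a', p, q, b'; move: py zq; rewrite (uniq_w y) // (uniq_w z) // => py zq.
by apply/and5P; split=> //; apply/andP.
Qed.

Lemma hexagon_strong a b c d p q : hexagon e a b c d p q ->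
  strong_in [set x in [:: a; b; c; d; p; q]] /\ 1 < #|[set x in [:: a; b; c; d; p; q]]|.
Proof.
move=> h; have /and5P[ab bc cd dp /andP[pq qa]] := h; split.
  by apply: cycle_strong; rewrite /= ab bc cd dp pq qa.
apply/card_gt1P; exists a, b; split; rewrite ?inE ?eqxx ?orbT //.
by apply/eqP => eab; have := ff_no2 ff ab; rewrite eab -{1}eab ab.
Qed.

End Tight.

(** * The colouring of a tight digraph by Z/3 *)

Section Colouring.

Variables (V : finType) (e : rel V) (X : {set V}).
Hypothesis ff : four_free_bip e X.
Hypothesis sV : strong_in e [set: V].
Hypothesis tight : nonadj_sum e X [set: V] + 6 <= 2 * #|V|.
Hypothesis V1 : 1 < #|V|.

Let no4 := ff_no4 ff.
Let no2 x y : e x y -> e y x -> False.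
Proof. by move=> /(ff_no2 ff)/negP. Qed.
Let side := side_neq ff.

Lemma hexagon_in_cycle (c : seq V) : ucycle e c -> c != [::] ->
  exists a b d p q f, hexagon e a b d p q f /\ all (mem c) [:: a; b; d; p; q; f].
Proof.
case/andP=> cyc uc nc; have sc := cycle_strong cyc.
have c1 : 1 < #|[set x in c]|.
  rewrite cardsE (card_uniqP uc); case: c nc cyc {uc sc} => [|x [|y c]] //= _.
  by rewrite andbT => xx; case: (no2 xx xx).
have [a [b [d [p [q [f [h hall]]]]]]] := tight_hexagon ff sV tight sc c1.
exists a, b, d, p, q, f; split=> //; apply: sub_all hall => x; by rewrite /= inE.
Qed.

Lemma hexagon_opp a b c d p q y : hexagon e a b c d p q ->
  y \in [:: a; b; c; d; p; q] -> nonadj e X a y -> y = d.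
Proof.
move=> /and5P[ab bc cd dp /andP[pq qa]].
rewrite !inE => yl /and3P[say nay nya].
move: yl => /or4P[/eqP yE|/eqP yE|/eqP yE|/or3P[/eqP yE|/eqP yE|/eqP yE]] //; subst y.
- by rewrite eqxx in say.
- by rewrite ab in nay.
- by move: say; rewrite (side ab) (side bc) negbK eqxx.
- by move: say; rewrite (side pq) (side qa) negbK eqxx.
- by rewrite qa in nya.
Qed.

Lemma hexagon_opp_unique a b c d p q u y z : hexagon e a b c d p q ->
  u \in [:: a; b; c; d; p; q] -> y \in [:: a; b; c; d; p; q] -> z \in [:: a; b; c; d; p; q] ->
  nonadj e X u y -> nonadj e X u z -> y = z.
Proof.
move=> h0 ul yl zl.
have rotE (x a' b' c' d' p' q' : V) : x \in [:: a'; b'; c'; d'; p'; q'] -> x \in [:: b'; c'; d'; p'; q'; a'].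
  by rewrite -(mem_rot 1).
have h1 := hexagon_rot h0; have h2 := hexagon_rot h1; have h3 := hexagon_rot h2.
have h4 := hexagon_rot h3; have h5 := hexagon_rot h4.
have y1 := rotE _ _ _ _ _ _ _ yl; have y2 := rotE _ _ _ _ _ _ _ y1.
have y3 := rotE _ _ _ _ _ _ _ y2; have y4 := rotE _ _ _ _ _ _ _ y3.
have y5 := rotE _ _ _ _ _ _ _ y4.
have z1 := rotE _ _ _ _ _ _ _ zl; have z2 := rotE _ _ _ _ _ _ _ z1.
have z3 := rotE _ _ _ _ _ _ _ z2; have z4 := rotE _ _ _ _ _ _ _ z3.
have z5 := rotE _ _ _ _ _ _ _ z4.
move: ul; rewrite !inE => /or4P[|||/or3P[||]] /eqP -> uy uz.
- by rewrite (hexagon_opp h0 yl uy) (hexagon_opp h0 zl uz).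
- by rewrite (hexagon_opp h1 y1 uy) (hexagon_opp h1 z1 uz).
- by rewrite (hexagon_opp h2 y2 uy) (hexagon_opp h2 z2 uz).
- by rewrite (hexagon_opp h3 y3 uy) (hexagon_opp h3 z3 uz).
- by rewrite (hexagon_opp h4 y4 uy) (hexagon_opp h4 z4 uz).
- by rewrite (hexagon_opp h5 y5 uy) (hexagon_opp h5 z5 uz).
Qed.

Lemma nonadj_irr v : nonadj e X v v = false.
Proof. by rewrite /nonadj /= eqxx. Qed.

(** On a hexagon the nonadjacent pairs form a matching, and a new vertex with a single nonneighbour
    lies on no 4-cycle of nonadjacent pairs. *)
Lemma tight_nonadj u v y z : nonadj e X u y -> nonadj e X v y ->
  nonadj e X u z -> nonadj e X v z -> u = v \/ y = z.
Proof.
pose P (U : {set V}) := forall u v y z, u \in U -> v \in U -> y \in U -> z \in U ->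
  nonadj e X u y -> nonadj e X v y -> nonadj e X u z -> nonadj e X v z -> u = v \/ y = z.
suff : P [set: V] by apply; rewrite inE.
have [a [b [c [d [p [q [h _]]]]]]] := tight_hexagon ff sV tight sV (etrans (congr1 _ (cardsT V)) V1).
have [sU U1] := hexagon_strong ff h.
apply: (leaf_ind ff sV tight sU U1).
  move=> {}u {}v {}y {}z; rewrite !in_set => uU vU yU zU uy vy uz vz; right.
  exact: hexagon_opp_unique h uU yU zU uy uz.
move=> U v0 w _ _ v0U wU _ v0w uniq_w PU {}u {}v {}y {}z.
have nb t s : t \in v0 |: U -> nonadj e X s t -> s = v0 -> t = w.
  move=> tW st sv; rewrite sv in st; move: tW; rewrite !inE => /predU1P[tv|tU].
    by rewrite tv nonadj_irr in st.
  exact: uniq_w.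
move=> uW vW yW zW uy vy uz vz.
have [uv|uv] := eqVneq u v0.
  by right; rewrite (nb _ _ yW uy uv) (nb _ _ zW uz uv).
have [vv|vv] := eqVneq v v0.
  by right; rewrite (nb _ _ yW vy vv) (nb _ _ zW vz vv).
have [yv|yv] := eqVneq y v0.
  by left; rewrite (nb u y) // 1?(nb v y) // nonadj_sym.
have [zv|zv] := eqVneq z v0.
  by left; rewrite (nb u z) // 1?(nb v z) // nonadj_sym.
move: uW vW yW zW; rewrite !inE (negbTE uv) (negbTE vv) (negbTE yv) (negbTE zv) /=.
move=> *; exact: PU.
Qed.

Lemma hexagon_neq a b c d p q : hexagon e a b c d p q ->
  [/\ b != a, b != d, c != a, c != b & [/\ c != d, c != p, p != a, p != d & [/\ q != a, q != d, q != b & q != p]]].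
Proof.
move=> /and5P[ab bc cd dp /andP[pq qa]].
have n1 x y : e x y -> x != y by move=> xy; apply/eqP => E; apply: (no2 xy); rewrite -{1}E -E in xy *.
have n2 x y z : e x y -> e y z -> x != z.
  by move=> xy yz; apply/eqP => E; apply: (no2 xy); rewrite E.
have sn (x y : V) : (x \in X) = ~~ (y \in X) -> x != y.
  by move=> xy; apply/eqP => E; move: xy; rewrite E; case: (y \in X).
split; [by rewrite eq_sym n1|exact: n2 bc cd|by rewrite eq_sym (n2 _ _ _ ab)|by rewrite eq_sym n1|].
split; [exact: n1|exact: n2 cd dp|exact: n2 pq qa|by rewrite eq_sym n1|].
split; [exact: n1|by rewrite eq_sym (n2 _ _ _ dp)|exact: n2 qa ab|by rewrite eq_sym n1].
Qed.

Lemma colouring_exists : exists (tau : V -> 'Z_3) a b c d p q,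
  [/\ forall x y, nonadj e X x y -> tau x = tau y, hexagon e a b c d p q,
      tau a = 0%R, tau b = 1%R & tau c = (1 + 1)%R].
Proof.
have [a [b [c [d [p [q [h _]]]]]]] := tight_hexagon ff sV tight sV (etrans (congr1 _ (cardsT V)) V1).
pose P (U : {set V}) := exists tau : V -> 'Z_3,
  [/\ forall x y, x \in U -> y \in U -> nonadj e X x y -> tau x = tau y, [/\ a \in U, b \in U & c \in U],
      tau a = 0%R, tau b = 1%R & tau c = (1 + 1)%R].
suff [tau [tN _ ta tb tc]] : P [set: V].
  by exists tau, a, b, c, d, p, q; split=> // x y; apply: tN.
have [sU U1] := hexagon_strong ff h.
apply: (leaf_ind ff sV tight sU U1).
  (* Opposite vertices of the hexagon receive the same colour. *)
  pose tau x : 'Z_3 := if x \in [:: a; d] then 0%R else if x \in [:: b; p] then 1%R else (1 + 1)%R.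
  have [ba bd ca cb [cd cp pa pd [qa qd qb qp]]] := hexagon_neq h.
  have ta : tau a = 0%R by rewrite /tau !inE eqxx.
  have td : tau d = 0%R by rewrite /tau !inE eqxx orbT.
  have tb : tau b = 1%R by rewrite /tau !inE (negbTE ba) (negbTE bd) eqxx.
  have tp : tau p = 1%R by rewrite /tau !inE (negbTE pa) (negbTE pd) eqxx orbT.
  have tc : tau c = (1 + 1)%R by rewrite /tau !inE (negbTE ca) (negbTE cb) (negbTE cd) (negbTE cp).
  have tq : tau q = (1 + 1)%R by rewrite /tau !inE (negbTE qa) (negbTE qb) (negbTE qd) (negbTE qp).
  exists tau; split=> //; last by rewrite !inE !eqxx ?orbT.
  move=> x y; rewrite !in_set => xU yU xy.
  have opp a' b' c' d' p' q' : hexagon e a' b' c' d' p' q' ->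
      a' \in [:: a; b; c; d; p; q] -> d' \in [:: a; b; c; d; p; q] -> x = a' -> y = d'.
    move=> h' aU dU xa; apply: (hexagon_opp_unique h xU yU dU xy).
    by rewrite xa; apply: hexagon_nonadj h'.
  have h1 := hexagon_rot h; have h2 := hexagon_rot h1; have h3 := hexagon_rot h2.
  have h4 := hexagon_rot h3; have h5 := hexagon_rot h4.
  have := xU; rewrite !inE => /or4P[|||/or3P[||]] /eqP xE; rewrite xE.
  - by rewrite (opp _ _ _ _ _ _ h _ _ xE) ?ta ?td // !inE eqxx ?orbT.
  - by rewrite (opp _ _ _ _ _ _ h1 _ _ xE) ?tb ?tp // !inE eqxx ?orbT.
  - by rewrite (opp _ _ _ _ _ _ h2 _ _ xE) ?tc ?tq // !inE eqxx ?orbT.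
  - by rewrite (opp _ _ _ _ _ _ h3 _ _ xE) ?ta ?td // !inE eqxx ?orbT.
  - by rewrite (opp _ _ _ _ _ _ h4 _ _ xE) ?tb ?tp // !inE eqxx ?orbT.
  - by rewrite (opp _ _ _ _ _ _ h5 _ _ xE) ?tc ?tq // !inE eqxx ?orbT.
move=> U v w _ _ vU wU _ vw uniq_w [tau [tN [aU bU cU] ta tb tc]].
have nv x : x \in U -> (x == v) = false by move=> xU; apply/eqP => xv; rewrite -xv xU in vU.
(* The new vertex takes the colour of its only nonneighbour. *)
exists (fun x => if x == v then tau w else tau x); split; rewrite ?nv //.
  move=> x y; rewrite !inE => /predU1P[->|xU] /predU1P[->|yU]; rewrite ?eqxx ?nv // ?nonadj_irr //.
  - by move=> vy; rewrite (uniq_w y).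
  - by rewrite nonadj_sym => vx; rewrite (uniq_w x).
  - exact: tN.
by rewrite !inE aU bU cU !orbT.
Qed.

Variable tau : V -> 'Z_3.
Hypothesis tauN : forall x y, nonadj e X x y -> tau x = tau y.

Lemma tau_adj x y : (x \in X) != (y \in X) -> tau x != tau y -> e x y || e y x.
Proof.
move=> sxy; apply: contra_neqT; rewrite negb_or => /andP[nxy nyx].
by apply: tauN; apply/and3P.
Qed.

Lemma tau_adj_out x y : (x \in X) = ~~ (y \in X) -> tau x != tau y -> (e y x -> False) -> e x y.
Proof.
move=> sxy txy nyx; have /orP[//|/nyx//] : e x y || e y x.
by apply: tau_adj => //; rewrite sxy; case: (y \in X).
Qed.

Variables a0 b0 c0 d0 p0 q0 : V.
Hypothesis h0 : hexagon e a0 b0 c0 d0 p0 q0.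
Hypotheses (ta0 : tau a0 = 0%R) (tb0 : tau b0 = 1%R) (tc0 : tau c0 = (1 + 1)%R).

Lemma hexagon_tau_opp a b c d p q : hexagon e a b c d p q ->
  [/\ tau d = tau a, tau p = tau b & tau q = tau c].
Proof.
move=> h; have h1 := hexagon_rot h; have h2 := hexagon_rot h1.
by split; apply/esym/tauN; apply: (hexagon_nonadj ff); eassumption.
Qed.

(** Leaf extension from the given hexagon introduces no new colours, and the reference hexagon at
    [a0] shows that all three occur. *)
Lemma hexagon_tau_all a b c d p q t : hexagon e a b c d p q -> t \in [:: tau a; tau b; tau c].
Proof.
move=> h; have [sU U1] := hexagon_strong ff h.
have all_tau x : tau x \in [:: tau a; tau b; tau c].
  pose P (U : {set V}) := forall x, x \in U -> tau x \in [:: tau a; tau b; tau c].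
  suff : P [set: V] by apply; rewrite inE.
  apply: (leaf_ind ff sV tight sU U1) => [{}x|U v w _ _ vU wU _ vw _ PU {}x].
    have [td tp tq] := hexagon_tau_opp h.
    rewrite inE !inE => /or4P[|||/or3P[||]] /eqP ->; rewrite ?td ?tp ?tq eqxx ?orbT //.
  by rewrite !inE => /predU1P[->|/PU]; rewrite ?(tauN vw) -?in_cons //; have := PU w wU; rewrite !inE.
case: (Z3_cases 0%R t) => <-; rewrite ?GRing.add0r.
- by rewrite -ta0.
- by rewrite -tb0.
- by rewrite -tc0.
Qed.

(** Since [a], [b], [c] carry all three colours, the colour runs around the hexagon either upwards
    or downwards. *)
Lemma hexagon_sign a b c d p q : hexagon e a b c d p q ->
  (tau b = tau a + 1 /\ tau c = tau a + 1 + 1)%R \/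
  (tau b = tau a + 1 + 1 /\ tau c = tau a + 1)%R.
Proof.
move=> h; have := hexagon_tau_all (tau a + 1)%R h.
have := hexagon_tau_all (tau a + 1 + 1)%R h.
rewrite !inE tau_succ tau_succ2 /= => /orP[/eqP <-|/eqP <-].
  by rewrite eq_sym tau_succ /= => /eqP <-; right.
by rewrite [X in _ || X]eq_sym tau_succ orbF => /eqP <-; left.
Qed.

Lemma hexagon_pos_rot a b c d p q : hexagon e a b c d p q ->
  (tau b = tau a + 1)%R -> (tau c = tau b + 1)%R.
Proof.
move=> h tb; case: (hexagon_sign h) => -[tb' tc]; first by rewrite tc tb.
by have := tau_succ (tau a + 1)%R; rewrite -tb' -tb eqxx.
Qed.

(* For two oppositely oriented hexagons through a, excluding one 4-cycle after
   another fixes the direction of p b', p d', c d' and c q', and then a b c q' is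
   a 4-cycle. *)
Lemma hexagon_same_sign a b c d p q b' c' d' p' q' :
  hexagon e a b c d p q -> (tau b = tau a + 1)%R -> hexagon e a b' c' d' p' q' ->
  (tau b' = tau a + 1)%R.
Proof.
move=> h tb h'; case: (hexagon_sign h') => -[tb' tc'] //; exfalso.
have tc : (tau c = tau a + 1 + 1)%R by rewrite (hexagon_pos_rot h tb) tb.
have [td tp tq] := hexagon_tau_opp h; have [td' tp' tq'] := hexagon_tau_opp h'.
case/and5P: h => ab bc cd dp /andP[pq qa].
case/and5P: h' => ab' bc' cd' dp' /andP[pq' qa'].
have sq : (q \in X) = ~~ (a \in X) := side qa.
have sp : (p \in X) = (a \in X) by rewrite (side pq) sq negbK.
have sd : (d \in X) = ~~ (a \in X) by rewrite (side dp) sp.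
have sc : (c \in X) = (a \in X) by rewrite (side cd) sd negbK.
have sq' : (q' \in X) = ~~ (a \in X) := side qa'.
have sp' : (p' \in X) = (a \in X) by rewrite (side pq') sq' negbK.
have sd' : (d' \in X) = ~~ (a \in X) by rewrite (side dp') sp'.
have sc' : (c' \in X) = (a \in X) by rewrite (side cd') sd' negbK.
have sb' : (b' \in X) = ~~ (a \in X) by rewrite (side bc') sc'.
have pb' : e p b'.
  apply: tau_adj_out; first by rewrite sp sb' negbK.
    by rewrite tp tb tb' eq_sym tau_succ.
  by move=> b'p; apply: (no4 b'p pq qa ab').
have pd' : e p d'.
  apply: tau_adj_out; first by rewrite sp sd' negbK.
    by rewrite tp tb td' tau_succ.
  by move=> d'p; apply: (no4 d'p pb' bc' cd').
have cd'' : e c d'.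
  apply: tau_adj_out; first by rewrite sc sd' negbK.
    by rewrite tc td' tau_succ2.
  by move=> d'c; apply: (no4 d'c cd dp pd').
have cq' : e c q'.
  apply: tau_adj_out; first by rewrite sc sq' negbK.
    by rewrite tc tq' tc' tau_succ.
  by move=> q'c; apply: (no4 q'c cd'' dp' pq').
exact: no4 qa' ab bc cq'.
Qed.

(** By [hexagon_same_sign] one upward hexagon through each vertex suffices. A new vertex shares a
    hexagon with its nonneighbour [w], for which an upward hexagon is already known. *)
Lemma hexagon_pos a b c d p q : hexagon e a b c d p q -> (tau b = tau a + 1)%R.
Proof.
pose P (U : {set V}) := forall x, x \in U ->
  exists b c d p q, hexagon e x b c d p q /\ (tau b = tau x + 1)%R.
suff : P [set: V].
  move=> /(_ a (in_setT a)) [b' [c' [d' [p' [q' [h' tb']]]]]] h.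
  exact: hexagon_same_sign h' tb' h.
have [sU U1] := hexagon_strong ff h0.
apply: (leaf_ind ff sV tight sU U1).
  have t0 : (tau b0 = tau a0 + 1)%R by rewrite ta0 tb0 GRing.add0r.
  have h1 := hexagon_rot h0; have t1 := hexagon_pos_rot h0 t0.
  have h2 := hexagon_rot h1; have t2 := hexagon_pos_rot h1 t1.
  have h3 := hexagon_rot h2; have t3 := hexagon_pos_rot h2 t2.
  have h4 := hexagon_rot h3; have t4 := hexagon_pos_rot h3 t3.
  have h5 := hexagon_rot h4; have t5 := hexagon_pos_rot h4 t4.
  move=> x; rewrite !inE => /or4P[|||/or3P[||]] /eqP ->; by do 5 eexists; split; eassumption.
move=> U v w sU' U1' vU wU sW vw uniq_w PU x; rewrite !inE => /predU1P[->|]; last exact: PU.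
have [a' [p' [q' [b' h]]]] := leaf_hexagon ff sU' sW U1' vU uniq_w.
exists a', p', w, q', b'; split=> //.
have h3 := hexagon_rot (hexagon_rot (hexagon_rot h)).
have [bw [cw [dw [pw [qw [hw tw]]]]]] := PU w wU.
have tq := hexagon_same_sign hw tw h3.
have h4 := hexagon_rot h3; have t4 := hexagon_pos_rot h3 tq.
have h5 := hexagon_rot h4; have t5 := hexagon_pos_rot h4 t4.
exact: hexagon_pos_rot h5 t5.
Qed.

End Colouring.

Lemma tight_hexagonal (V : finType) (e : rel V) (X : {set V}) :
  four_free_bip e X -> strong_in e [set: V] -> 1 < #|V| ->
  nonadj_sum e X [set: V] + 6 <= 2 * #|V| -> exists tau, hexagonal e X tau.
Proof.
move=> ff sV V1 tight.
have [tau [a [b [c [d [p [q [tN h ta tb tc]]]]]]]] := colouring_exists ff sV tight V1.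
exists tau; split=> //.
- exact: tau_adj tN.
- by move=> *; apply: (hexagon_pos ff sV tight tN h ta tb tc); eassumption.
- by move=> u v y z; apply: (tight_nonadj ff sV tight V1).
Qed.

(** Sum [beta_class] over the six classes: each class occurs once as tail and once as head, so the
    right-hand sides add up to [2 * #|V|]. *)
Lemma beta_hexagonal (V : finType) (e : rel V) (X : {set V}) tau :
  hexagonal e X tau ->
  (forall c, ucycle e c -> c != [::] -> exists a b d p q f,
     hexagon e a b d p q f /\ all (mem c) [:: a; b; d; p; q; f]) ->
  (exists a b c d p q, hexagon e a b c d p q) -> 3 * (beta e).+1 <= #|V|.
Proof.
move=> hx hcyc [a [b [c [d [p [q h]]]]]].
pose cls (j : 'Z_3 * bool) := tail_class X tau j.1 j.2.
have sum_cls : \sum_j #|cls j| = #|V|.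
  rewrite -sum1_card (partition_big (fun x => (tau x, x \in X)) predT) //=.
  apply: eq_bigr => -[i s] _; rewrite sum1dep_card; apply: eq_card => x.
  by rewrite !inE xpair_eqE andbC.
pose succ (j : 'Z_3 * bool) := ((j.1 + 1)%R, ~~ j.2).
have succ_bij : bijective succ.
  exists (fun j => ((j.1 - 1)%R, ~~ j.2)) => -[i s]; rewrite /succ /= negbK.
    by rewrite GRing.addrK.
  by rewrite GRing.subrK.
have sum_succ : \sum_j #|cls (succ j)| = #|V|.
  by rewrite -sum_cls [RHS](reindex succ) //; apply: onW_bij.
have : \sum_(j : 'Z_3 * bool) (beta e).+1 <= \sum_j (#|cls j| + #|cls (succ j)|).
  apply: leq_sum => -[i s] _; apply: (beta_class hx hcyc).
  have [a' [b' [c' [d' [p' [q' [_ _ a'T]]]]]]] := hexagon_tail_class hx i s (P := predT) h isT.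
  by apply/set0Pn; exists a'.
rewrite big_split /= sum_cls sum_succ sum_nat_const card_prod card_bool card_ord.
have -> : (Zp_trunc 3).+2 = 3 by [].
by move: (beta e) #|V| => n m; clear; lia.
Qed.

(** * Edges and nonadjacent pairs *)

Section Counting.

Variables (V : finType) (X Y : {set V}).
Implicit Types e : rel V.

Lemma four_free_bipP e : bipartite X Y e -> Defs.free 4 e -> four_free_bip e X.
Proof.
case=> XY dXY bip /forallP fr.
have YX y : y \in Y -> (y \in X) = false by move=> yY; apply: disjointFl dXY yY.
have b x y : e x y -> (x \in X) != (y \in X).
  by case/bip/orP => /andP[xS yS]; [rewrite xS (YX _ yS) | rewrite (YX _ xS) yS].
have nc c : size c <= 4 -> ucycle e c -> c = [::].
  by move=> szc ec; apply/nilP/(implyP (fr (Bseq szc))).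
have n2 x y : e x y -> ~~ e y x.
  move=> xy; apply/negP => yx; suff /nc : ucycle e [:: x; y] by case/(_ isT).
  rewrite /ucycle /ucycleb /= xy yx /= inE andbT.
  by apply/eqP => E; have := b _ _ xy; rewrite E eqxx.
split=> // p q r s pq qr rs sp; suff /nc : ucycle e [:: p; q; r; s] by case/(_ isT).
have n x y : e x y -> x != y by move=> /b; apply: contraNneq => ->.
rewrite /ucycle /ucycleb /= pq qr rs sp /= !inE !negb_or.
rewrite (n p q) // (n q r) // (n r s) // (eq_sym p s) (n s p) //= !andbT.
apply/andP; split; apply/eqP => E.
  by have := n2 _ _ pq; rewrite E qr.
by have := n2 _ _ qr; rewrite E rs.
Qed.

Lemma bipartite_compl e : bipartite X Y e -> Y = ~: X.
Proof.
case=> XY dXY _; apply/setP => y; rewrite inE; apply/idP/idP => [yY|yX].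
  by rewrite (disjointFl dXY yY).
by have := in_setT y; rewrite -XY inE (negbTE yX).
Qed.

Lemma nonadjE e x y : x \in X -> y \notin X -> nonadj e X x y = ~~ adjacent e x y.
Proof.
move=> xX yX; rewrite /nonadj /adjacent /= xX (negbTE yX) /= negb_and negb_or.
by case: eqVneq => [xy|//]; rewrite -xy xX in yX.
Qed.

(** Without opposite edges each adjacent pair carries exactly one edge. Hence having the most edges
    means having the fewest nonadjacent pairs. *)
Lemma gamma_edges e : bipartite X Y e -> four_free_bip e X ->
  #|edges e| + gamma X Y e = #|X| * #|Y|.
Proof.
move=> bip ff; have YX := bipartite_compl bip.
rewrite -cardsX -(cardsID [set p | adjacent e p.1 p.2] (setX X Y)); congr (_ + _); last first.
  by rewrite /gamma; apply: eq_card => p; rewrite !inE andbC.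
pose f (p : V * V) := if p.1 \in X then p else (p.2, p.1).
have finj : {in edges e &, injective f}.
  move=> [a b] [c d]; rewrite !inE /= => ab cd; rewrite /f /=.
  by case: ifP => aX; case: ifP => cX // [E1 E2]; subst;
     rewrite ?(negbTE (ff_no2 ff ab)) in cd *.
rewrite -(card_in_imset finj); apply: eq_card => -[x y]; rewrite !inE /= YX inE.
apply/imsetP/andP => [[[a b]]|[/andP[xX yX] /andP[xy /orP[exy|eyx]]]].
- rewrite inE /= => ab; have s := side_neq ff ab; have nab : a != b.
    by apply/eqP => E; move: s; rewrite E; case: (b \in X).
  rewrite /f /=; case: ifP => aX [-> ->].
    by split; [rewrite -s aX | rewrite /adjacent nab ab].
  split; last by rewrite /adjacent eq_sym nab ab orbT.
  by move: s; rewrite aX; case: (b \in X).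
- by exists (x, y); rewrite ?inE // /f /= xX.
- by exists (y, x); rewrite ?inE // /f /= (negbTE yX).
Qed.

Lemma gamma_nonadj_sum e : Y = ~: X -> nonadj_sum e X [set: V] = 2 * gamma X Y e.
Proof.
move=> YX; have E x : nonadj_deg e X x [set: V] = \sum_y nonadj e X x y.
  by rewrite /nonadj_deg -sum1dep_card [LHS]big_mkcond; apply: eq_bigr => y _; rewrite inE; case: (nonadj _ _ _ _).
have G : gamma X Y e = \sum_(x in X) \sum_(y in ~: X) nonadj e X x y.
  rewrite /gamma -sum1_card pair_big_dep /= YX [LHS]big_mkcond [RHS]big_mkcond.
  apply: eq_bigr => -[x y] _; rewrite !inE /=; case xX: (x \in X) => //=.
  by case yX: (y \in X) => //=; rewrite nonadjE ?xX ?yX //; case: (~~ _).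
have G1 : gamma X Y e = \sum_(x in X) \sum_y nonadj e X x y.
  rewrite G; apply: eq_bigr => x xX; rewrite [LHS]big_mkcond; apply: eq_bigr => y _.
  by rewrite inE /nonadj /= xX; case: (y \in X).
have G2 : gamma X Y e = \sum_(x in ~: X) \sum_y nonadj e X x y.
  rewrite G exchange_big; apply: eq_bigr => x xX; rewrite [LHS]big_mkcond; apply: eq_bigr => y _.
  by rewrite nonadj_sym; move: xX; rewrite inE /nonadj /= => /negbTE ->; case: (y \in X).
rewrite mul2n -addnn {1}G1 G2 /nonadj_sum (bigID [in X]) /=; congr (_ + _).
  by apply: eq_big => x; rewrite ?inE // => _; apply: E.
by apply: eq_big => x; rewrite ?inE // => _; apply: E.
Qed.

End Counting.

(** * The blow-up of the directed hexagon *)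

Section Blowup.

Variables (V : finType) (X Y : {set V}).
Hypotheses (XY : X :|: Y = [set: V]) (dXY : [disjoint X & Y]).
Variables x0 x2 x4 y1 y3 y5 : V.
Hypotheses (x0X : x0 \in X) (x2X : x2 \in X) (x4X : x4 \in X).
Hypotheses (y1Y : y1 \in Y) (y3Y : y3 \in Y) (y5Y : y5 \in Y).
Hypotheses (x04 : x0 != x4) (x02 : x0 != x2) (x24 : x2 != x4).
Hypotheses (y13 : y1 != y3) (y15 : y1 != y5) (y35 : y3 != y5).

(** Classes 0, 4, 1 and 5 are the singletons of [x0], [x4], [y1] and [y5]; all other vertices of [X]
    go to class 2 and all others of [Y] to class 3. *)
Definition blowup_class (v : V) : 'Z_6 :=
  if v \in X then (if v == x0 then 0 else if v == x4 then 4%:R else 2%:R)%R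
  else (if v == y1 then 1 else if v == y5 then 5%:R else 3%:R)%R.

Definition blowup : rel V := fun u v => blowup_class v == (blowup_class u + 1)%R.

Let YX y : y \in Y -> (y \in X) = false.
Proof. by move=> yY; apply: disjointFl dXY yY. Qed.

Lemma blowup_loopless : loopless blowup.
Proof. by move=> v; rewrite /blowup; case: (blowup_class v) => [[|[|[|[|[|[|//]]]]]] ?]. Qed.

Lemma blowup_class_side v : odd (blowup_class v) = (v \notin X).
Proof. by rewrite /blowup_class; case: (v \in X); case: ifP => // _; case: ifP. Qed.

Lemma odd_succ (t : 'Z_6) : odd (t + 1)%R = ~~ odd t.
Proof. by case: t => [[|[|[|[|[|[|//]]]]]] ?]. Qed.

Lemma blowup_bipartite : bipartite X Y blowup.
Proof.
split=> // u v /eqP uv.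
have inY w : (w \notin X) = (w \in Y).
  have := in_setT w; rewrite -XY inE; case: (boolP (w \in X)) => /= [wX _|_ ->//].
  by apply/esym/negbTE/negP => /YX wX'; rewrite wX' in wX.
have := blowup_class_side v; rewrite uv odd_succ blowup_class_side.
by rewrite -!inY; case: (u \in X); case: (v \in X).
Qed.

(** The class rises by 1 modulo 6 along each edge, so closed walks have length divisible by 6. *)
Lemma blowup_free : Defs.free 4 blowup.
Proof.
apply/forallP => -[c /= szc]; apply/implyP; case: c szc => [//|a [|b [|c [|d [|//]]]]] _;
  rewrite /ucycleb /= /blowup; move: (blowup_class a) => t.
- by case: t => [[|[|[|[|[|[|//]]]]]] ?].
- case/andP=> /and3P[/eqP -> /eqP + _] _.
  by case: t => [[|[|[|[|[|[|//]]]]]] ?].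
- case/andP=> /and4P[/eqP -> /eqP -> /eqP + _] _.
  by case: t => [[|[|[|[|[|[|//]]]]]] ?].
- case/andP=> /and5P[/eqP -> /eqP -> /eqP -> /eqP + _] _.
  by case: t => [[|[|[|[|[|[|//]]]]]] ?].
Qed.

Lemma blowup_class_onto (t : 'Z_6) : exists v, blowup_class v = t.
Proof.
have c0 : blowup_class x0 = 0%R by rewrite /blowup_class x0X eqxx.
have c1 : blowup_class y1 = 1%R by rewrite /blowup_class YX // eqxx.
have c2 : blowup_class x2 = 2%:R%R.
  by rewrite /blowup_class x2X eq_sym (negbTE x02) (negbTE x24).
have c3 : blowup_class y3 = 3%:R%R.
  by rewrite /blowup_class YX // eq_sym (negbTE y13) (negbTE y35).
have c4 : blowup_class x4 = 4%:R%R by rewrite /blowup_class x4X eq_sym (negbTE x04) eqxx.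
have c5 : blowup_class y5 = 5%:R%R.
  by rewrite /blowup_class YX // eq_sym (negbTE y15) eqxx.
case: t => [[|[|[|[|[|[|//]]]]]] lt]; [exists x0|exists y1|exists x2|exists y3|exists x4|exists y5];
  by rewrite ?(c0, c1, c2, c3, c4, c5); apply: val_inj.
Qed.

Lemma blowup_strong : strong blowup.
Proof.
have walk n : forall u v, (blowup_class v = blowup_class u + n.+1%:R)%R -> connect blowup u v.
  elim: n => [|n IH] u v uv; first by apply/connect1/eqP.
  have [w uw] := blowup_class_onto (blowup_class u + 1)%R.
  apply: (@connect_trans _ _ w); first by apply/connect1/eqP.
  by apply: IH; rewrite uv uw -GRing.addrA -GRing.mulrS.
(* The walk has the class difference plus 6 steps; the extra full turn covers vertices of the same
   class. *)
move=> u v; apply: (walk ((blowup_class v - blowup_class u)%R + 5)).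
have six : (6%:R = 0 :> 'Z_6)%R by apply: val_inj.
by rewrite -addnS GRing.natrD natr_Zp six GRing.addr0 GRing.addrC GRing.subrK.
Qed.

Lemma gamma_blowup : gamma X Y blowup + 3 <= #|V|.
Proof.
(* Only the opposite classes 0 and 3, 4 and 1, 2 and 5 are nonadjacent across the sides, which gives
   [(#|Y| - 2) + 1 + (#|X| - 2)] pairs. *)
pose N := setX [set x0] (Y :\ y1 :\ y5) :|: [set (x4, y1)] :|: setX (X :\ x0 :\ x4) [set y5].
have cV : #|V| = #|X| + #|Y| by rewrite -cardsT -XY cardsU disjoint_setI0 // cards0 subn0.
have cX : #|X| = #|X :\ x0 :\ x4|.+2.
  by rewrite (cardsD1 x0 X) x0X (cardsD1 x4 (X :\ x0)) !inE x4X eq_sym x04.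
have cY : #|Y| = #|Y :\ y1 :\ y5|.+2.
  by rewrite (cardsD1 y1 Y) y1Y (cardsD1 y5 (Y :\ y1)) !inE y5Y eq_sym y15.
have leN : #|N| <= #|Y :\ y1 :\ y5| + 1 + #|X :\ x0 :\ x4|.
  apply: leq_trans (leq_card_setU _ _) _; rewrite cardsX cards1 muln1 leq_add2r.
  by apply: leq_trans (leq_card_setU _ _) _; rewrite cardsX !cards1 mul1n.
suff leG : gamma X Y blowup <= #|N|.
  by rewrite cV cX cY; have := leq_trans leG leN; clear; lia.
apply: subset_leq_card; apply/subsetP => -[x y]; rewrite !inE /= => /andP[/andP[xX yY]].
have xy : x != y by apply: contraTneq xX => ->; rewrite YX.
rewrite /adjacent xy /= /blowup /blowup_class xX YX // negb_or xpair_eqE yY.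
have ex : (x == x0) && (x == x4) = false.
  by case: eqVneq => //= ->; rewrite (negbTE x04).
have ey : (y == y1) && (y == y5) = false.
  by case: eqVneq => //= ->; rewrite (negbTE y15).
by case: (x == x0) ex; case: (x == x4) => // _; case: (y == y1) ey; case: (y == y5).
Qed.

End Blowup.

(** * Tightness of Turán digraphs and the final bound *)

Lemma strong_inT (V : finType) (e : rel V) : strong e -> strong_in e [set: V].
Proof.
move=> str x y _ _; rewrite (eq_connect (e' := e)) // => a b.
by rewrite /within /= !inE.
Qed.

(** The blow-up of the hexagon competes in the maximality condition, so [gamma] is at most its
    number of nonadjacent pairs. *)
Lemma turan_nonadj_sum (V : finType) (X Y : {set V}) (e : rel V) :
  free_strong_bipartite_turan 4 X Y e -> 1 < #|V| ->
  nonadj_sum e X [set: V] + 6 <= 2 * #|V|.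
Proof.
move=> [[_ bip fr str] emax] V1; have ff := four_free_bipP bip fr.
have YX := bipartite_compl bip; have [XY dXY _] := bip.
have sV := strong_inT str.
have VT : 1 < #|[set: V]| by rewrite cardsT.
have sides (x : V) : 3 <= #|opp_side X [set: V] x| := opp_side_card ff x sV VT.
have [v _] := card_gt0P (ltnW V1 : 0 < #|V|).
have [w _ vw] := out_neighbour sV VT (in_setT v).
have opp_in x : opp_side X [set: V] x = if x \in X then Y else X.
  by apply/setP => y; rewrite !inE; case: (x \in X); rewrite ?YX ?inE; case: (y \in X).
(* The ends of an edge lie on different sides, and each has at least three vertices across; this
   leaves room for the blow-up. *)
have [X3 Y3] : 3 <= #|X| /\ 3 <= #|Y|.
  have := side_neq ff vw; have := sides v; have := sides w; rewrite !opp_in.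
  by case: (v \in X); case: (w \in X).
have [x0 [x2 [x4 [[x0X x2X x4X] [x02 x24 x40]]]]] := card_gt2P X3.
have [y1 [y3 [y5 [[y1Y y3Y y5Y] [y13 y35 y51]]]]] := card_gt2P Y3.
rewrite eq_sym in x40; rewrite eq_sym in y51.
pose b := blowup X x0 x4 y1 y5.
have bbip : bipartite X Y b by apply: blowup_bipartite.
have bfree : Defs.free 4 b by apply: blowup_free.
have bfsb : free_strong_bipartite 4 X Y b.
  split=> //; first exact: blowup_loopless.
  exact: (blowup_strong dXY x0X x2X x4X y1Y y3Y y5Y).
have := emax b bfsb; have := gamma_edges bip ff.
have := gamma_edges bbip (four_free_bipP bbip bfree).
have := gamma_blowup XY dXY x0X x4X y1Y y5Y x40 y51; rewrite -/b.
rewrite (gamma_nonadj_sum e YX); move: (gamma _ _ _) (gamma _ _ _) #|_| #|edges _| #|edges _|.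
by move: (#|X| * #|Y|); clear; lia.
Qed.

(** For more than one vertex, [3 * (beta e + 1)] is at most the number of vertices, which is at most
    [gamma X Y e + 3]. With at most one vertex there are no edges. *)
Lemma turan_beta_gamma (V : finType) (X Y : {set V}) (e : rel V) :
  free_strong_bipartite_turan 4 X Y e -> 3 * beta e <= gamma X Y e.
Proof.
move=> turan; have [[lp bip fr str] _] := turan.
have ff := four_free_bipP bip fr; have YX := bipartite_compl bip.
have [V1|V1] := leqP #|V| 1.
  suff -> : beta e = 0 by rewrite muln0.
  have [_ bmin] := betaP e; apply/eqP; rewrite -leqn0.
  apply: leq_trans (bmin _ (feedback_arc_set_edges e)) _.
  rewrite leqn0 cards_eq0; apply/eqP/setP => -[x y]; rewrite !inE /=.
  by rewrite (fintype_le1P V1 x y) lp.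
have tight := turan_nonadj_sum turan V1.
have sV := strong_inT str.
have VT : 1 < #|[set: V]| by rewrite cardsT.
have [tau hx] := tight_hexagonal ff sV V1 tight.
have [a [b [c [d [p [q [h _]]]]]]] := tight_hexagon ff sV tight sV VT.
have hex : exists a b c d p q, hexagon e a b c d p q by exists a, b, c, d, p, q.
have := beta_hexagonal hx (hexagon_in_cycle ff sV tight) hex.
have := strong_lower ff sV VT; rewrite cardsT (gamma_nonadj_sum e YX).
by move: (beta e) (gamma X Y e) #|V|; clear; lia.
Qed.

Theorem theorem1p6 (V : finType) (X Y : {set V}) (e : rel V)
    (G_turan : free_strong_bipartite_turan 4 X Y e) :
  ((beta e)%:R <= 1 / 3 * (gamma X Y e)%:R :> rat)%R.
Proof.
rewrite GRing.div1r Num.Theory.ler_pdivlMl // -GRing.natrM Num.Theory.ler_nat.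
exact: turan_beta_gamma G_turan.
Qed.
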